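(* Let $G$ be a hamiltonian decomposable directed graph of even order $n$, and let $m\geq 2$. The digraph $G\wr \vec{C}_{m}$ is hamiltonian decomposable in each of the following cases: (S1) $m$ is even, $m \geq 4$, and $n \geq 4$; (S2) $m=4$ and $n=2$; (S3) $m$ is odd and $m\geq 5$. Furthermore, if $G=\vec{C}_n$ and $m\in \{2,3\}$, then $G\wr \vec{C}_m$ is not hamiltonian decomposable.
   Context: All digraphs are strict (no loops, no repeated arcs). $\vec{C}_m$ denotes the directed cycle on $m$ vertices. A digraph is hamiltonian decomposable if its arc set can be partitioned into directed hamiltonian cycles. The wreath (lexicographic) product $G \wr H$ is the digraph with vertex set $V(G)\times V(H)$ in which $((g_1,h_1),(g_2,h_2))$ is an arc if and only if $(g_1,g_2)\in A(G)$, or $g_1=g_2$ and $(h_1,h_2)\in A(H)$. *)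

(* Defs.v *)
From mathcomp Require Import all_boot.

Set Implicit Arguments.
Unset Strict Implicit.
Unset Printing Implicit Defensive.

(* A digraph is a relation on a finite vertex type, hence has no repeated
   arcs; strictness is then [irreflexive]. *)

Section Digraph.
Variables (T : finType) (e : rel T).

Definition arcs : {set T * T} := [set p | e p.1 p.2].

Definition cycle_arcs (c : seq T) : {set T * T} :=
  [set p | (p.1 \in c) && (next c p.1 == p.2)].

Definition hamiltonian_cycle (A : {set T * T}) : Prop :=
  exists c : seq T,
    [/\ 1 < size c, ucycle e c, (forall x, x \in c) & A = cycle_arcs c].

(* [P != set0] is needed because [partition set0 set0] holds: without it an
   arcless digraph would count as decomposable. *)
Definition hamiltonian_decomposable : Prop :=
  exists P : {set {set T * T}},
    [/\ P != set0, partition P arcs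
      & forall A, A \in P -> hamiltonian_cycle A].

End Digraph.

Definition digraph_iso (T U : finType) (e : rel T) (e' : rel U) : Prop :=
  exists f : T -> U, bijective f /\ {mono f : x y / e x y >-> e' x y}.

Definition wreath (T U : finType) (g : rel T) (h : rel U) : rel (T * U) :=
  fun p q => g p.1 q.1 || (p.1 == q.1) && h p.2 q.2.

(* For m = 1 this is a loop, so it is a strict digraph only when m <> 1. *)
Definition dicycle (m : nat) : rel 'I_m := fun i j => j == ordS i.

Lemma dicycle_irr m : 1 < m -> irreflexive (@dicycle m).
Proof.
case: m => // m m1 i; apply/negP => /eqP /(congr1 val) /= h.
have := ltn_ord i; rewrite ltnS leq_eqVlt => /predU1P[im|im].
  by move: h; rewrite im modnn => m0; rewrite m0 in m1.
by move: h; rewrite modn_small // => /n_Sn.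
Qed.

Lemma wreath_irr (T U : finType) (g : rel T) (h : rel U) :
  irreflexive g -> irreflexive h -> irreflexive (wreath g h).
Proof. by move=> gi hi p; rewrite /wreath gi hi andbF. Qed.

(* Main.v *)
Require Import Defs.
From mathcomp Require Import fingroup perm ssralg zmodp zify all_boot.

Set Implicit Arguments.
Unset Strict Implicit.
Unset Printing Implicit Defensive.

(** A hamiltonian decomposition is a family of maps, each with a single orbit,
    whose graphs partition the arcs.  Fix one hamiltonian cycle [phi] of [G].
    Another cycle [psi] of [G] yields the [m] cycles [(t, x) -> (psi t, j - x)],
    with one layer twisted by [+1]; they close up because [n] is even.  So it
    remains to decompose the product of the directed cycle [phi] with [C_m].

    All layers carry the same colouring of their in-layer arcs.  A pair of
    equal consecutive transitions [x -> j - x] cancels, which reduces every even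
    [n] to [n = 2].  For [m >= 5] one colour runs through each layer from [0] to
    [m - 1], a second one uses the in-layer arc [m - 1 -> 0], and the rest is a
    pair of Latin squares [R], [s R0^-1] with [s = +1]: a row common to [R] and
    [R0] contributes the [m]-cycle [s].  A parity obstruction forbids [R = R0];
    for [m >= 7] they differ in three rows, where the product is [s] times one
    transposition (for the second special colour) or two crossing ones.  The
    remaining rows come from Hall's theorem.  For [m = 4, 5, 6] explicit tables
    are checked by computation.

    For [m = 2] the colour without in-layer arcs preserves the set of tails of
    another colour.  For [m = 3] each colour has a constant number of in-layer
    arcs per layer; completing them to permutations of the layers and comparing
    signs with that of a cycle of even length is contradictory, by a finite
    check of the possible transitions between two layers. *)

(** * Decompositions as families of single-orbit maps *)

Definition spanning (T : finType) (f : T -> T) : Prop :=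
  forall x y, fconnect f x y.

(** The orbit of [y] returns from [f y] to [y], so [y] has a preimage; a surjection of a finite set
    is injective. *)
Lemma spanning_inj (T : finType) (f : T -> T) : spanning f -> injective f.
Proof.
move=> sf; apply/injectiveP/card_uniqP; rewrite size_map -cardT.
apply: eq_card => y; rewrite inE; apply/mapP.
exists (iter (findex f (f y) y) f y); first by rewrite mem_enum.
by rewrite -iterS iterSr iter_findex.
Qed.

Lemma spanning_to (T : finType) (f : T -> T) (x0 : T) :
  injective f -> (forall x, fconnect f x x0) -> spanning f.
Proof.
move=> fI fx0 x y; apply: connect_trans (fx0 x) _.
by rewrite (fconnect_sym fI).
Qed.

Definition cycle_factorization (T : finType) (e : rel T) (K : finType)
    (f : K -> T -> T) : Prop :=
  [/\ forall k, spanning (f k), forall x, injective (f^~ x)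
    & forall x y, e x y = [exists k, f k x == y]].

Section Factorization.
Variables (T : finType) (e : rel T).

Lemma cycle_arcs_orbit (f : T -> T) (x0 : T) : spanning f ->
  cycle_arcs (orbit f x0) = [set p | f p.1 == p.2].
Proof.
move=> sf; have fI := spanning_inj sf.
apply/setP=> -[x y]; rewrite !inE /= -fconnect_orbit sf /=.
have := next_cycle (cycle_orbit fI x0) (x := x).
by rewrite -fconnect_orbit sf => /(_ isT) /eqP <-.
Qed.

Lemma factorization_decomposable (K : finType) (k0 : K) (f : K -> T -> T) :
  1 < #|T| -> cycle_factorization e f -> hamiltonian_decomposable e.
Proof.
move=> T1 [sf fI ef].
have x0 : T by case: (pickP T) T1 => // /eq_card0 ->.
pose A k := [set p : T * T | f k p.1 == p.2].
exists (A @: [set: K]); split.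
- by apply/set0Pn; exists (A k0); apply: imset_f.
- apply/and3P; split.
  + rewrite /cover; apply/eqP/setP=> -[x y]; rewrite !inE /= ef.
    apply/bigcupP/existsP => [[_ /imsetP[k _ ->]] | [k fk]].
      by rewrite inE => fk; exists k.
    by exists (A k); rewrite ?imset_f ?inE.
  + apply/trivIsetP=> _ _ /imsetP[k _ ->] /imsetP[l _ ->] nkl.
    rewrite -setI_eq0; apply: contraNT nkl => /set0Pn[[x y]].
    by rewrite !inE /= => /andP[/eqP <- /eqP/fI ->].
  + apply/imsetP=> -[k _ /setP/(_ (x0, f k x0))].
    by rewrite !inE /= eqxx.
- move=> _ /imsetP[k _ ->]; have fkI := spanning_inj (sf k).
  exists (orbit (f k) x0); split.
  + rewrite size_orbit /order; apply: leq_trans T1 _.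
    by apply: subset_leq_card; apply/subsetP => y _; apply: sf.
  + rewrite /ucycle orbit_uniq andbT.
    apply: sub_cycle (cycle_orbit fkI x0) => x y fxy.
    by rewrite ef; apply/existsP; exists k.
  + by move=> x; rewrite -fconnect_orbit sf.
  + by rewrite cycle_arcs_orbit.
Qed.

Lemma decomposable_factorization : hamiltonian_decomposable e ->
  1 < #|T| /\ exists (K : finType) (k0 : K) (f : K -> T -> T),
    cycle_factorization e f.
Proof.
case=> P [/set0Pn[A0 PA0] /and3P[/eqP covP /trivIsetP trP _] hP].
split.
  case: (hP _ PA0) => c [c1 /andP[_ uc] _ _].
  by rewrite (leq_trans c1) // -(card_uniqP uc) max_card.
(* The default [x] is never returned, because every block is a cycle through all vertices. *)
pose f (k : {A | A \in P}) x := odflt x [pick y | (x, y) \in val k].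
have fP k : exists c, [/\ ucycle e c, forall x, x \in c, f k =1 next c
    & val k = cycle_arcs c].
  case: (hP _ (valP k)) => c [_ uc cT Ak]; exists c; split=> // x.
  rewrite /f Ak; case: pickP => [y|/(_ (next c x))]; rewrite inE /= cT ?eqxx //.
  by move/eqP.
have fA (k : {A | A \in P}) x y : ((x, y) \in val k) = (f k x == y).
  by case: (fP k) => c [_ cT fE ->]; rewrite inE /= cT fE.
exists {A | A \in P}, (exist _ A0 PA0), f; split.
- move=> k x y; have [c [/andP[_ uc] cT fE _]] := fP k.
  by rewrite (eq_fconnect fE) (fconnect_cycle (cycle_next uc)) ?cT.
- move=> x k l /= fkl; apply: val_inj; apply: contraTeq isT => nkl.
  have := trP _ _ (valP k) (valP l) nkl.
  rewrite -setI_eq0 => /eqP/setP/(_ (x, f k x)).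
  by rewrite !inE !fA fkl eqxx.
- move=> x y; transitivity ((x, y) \in arcs e); first by rewrite inE.
  rewrite -covP; apply/bigcupP/existsP => [[A PA xyA]|[k fk]].
    by exists (exist _ A PA); rewrite -fA.
  by exists (val k); [apply: valP|rewrite fA].
Qed.
End Factorization.

(** * Layered maps *)

Section Layers.
Variables (T : finType) (phi : T -> T) (t0 : T).
Hypothesis sphi : spanning phi.

Let pos t := findex phi t0 t.

Lemma order_spanning t : order phi t = #|T|.
Proof. by apply: eq_card => y; apply: sphi. Qed.

Lemma iter_pos t : iter (pos t) phi t0 = t.
Proof. exact/iter_findex/sphi. Qed.

Lemma pos_lt t : pos t < #|T|.
Proof. by rewrite -(order_spanning t0) findex_max. Qed.

Lemma pos_iter i : i < #|T| -> pos (iter i phi t0) = i.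
Proof. by rewrite -(order_spanning t0) => /findex_iter. Qed.

Lemma iter_card t : iter #|T| phi t = t.
Proof. by rewrite -{1}(order_spanning t) iter_order //; apply: spanning_inj. Qed.

Variables (U : finType) (tail : pred U) (nx : U -> U) (st : U -> U).
Variables (s1 s2 rho : U -> U).

(** [s2] leaves the last layer and leads back to [t0], [s1] leaves the layer before it. For even
    [#|T|] the other layers are even in number, so that copies of [rho] can cancel in pairs. *)
Definition layer_step (i : nat) : U -> U :=
  if i.+1 == #|T| then s2 else if i.+2 == #|T| then s1 else rho.

Definition layered (p : T * U) : T * U :=
  if tail p.2 then (p.1, nx p.2) else (phi p.1, layer_step (pos p.1) p.2).

Hypothesis tail_st : forall x, ~~ tail (st x).
Hypothesis st_path : forall x, exists2 i, st x = iter i nx x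
  & forall j, j < i -> tail (iter j nx x).

Lemma layered_st t x : fconnect layered (t, x) (t, st x).
Proof.
case: (st_path x) => i -> tl; elim: i tl => [|i IH] tl //.
apply: connect_trans (IH _) _ => [j ji|]; first by apply: tl; lia.
by apply: connect1; rewrite /= /layered /= tl.
Qed.

Lemma layered_forward i x : i < #|T| -> ~~ tail x ->
  fconnect layered (iter i phi t0, x) (iter i.+1 phi t0, st (layer_step i x)).
Proof.
move=> iT tx; apply: connect_trans (layered_st _ _).
by apply: connect1; rewrite /= /layered /= (negbTE tx) pos_iter.
Qed.

Hypothesis T_even : ~~ odd #|T|.
Hypothesis rho_inv : forall x, ~~ tail x -> st (rho (st (rho x))) = x.
Hypothesis layered_inj : injective layered.
Variable x0 : U.
Hypothesis base : forall x, ~~ tail x -> fconnect (st \o s2 \o st \o s1) x x0.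

Lemma layered_lap x : ~~ tail x ->
  fconnect layered (t0, x) (t0, (st \o s2 \o st \o s1) x).
Proof.
move=> tx; have T0 : 0 < #|T| by apply/card_gt0P; exists t0.
have [h Th] : exists h, #|T| = h.*2.+2 by exists (#|T|./2.-1); lia.
have far j : j <= h -> fconnect layered (t0, x) (iter j.*2 phi t0, x).
  elim: j => [|j IH] jh //; apply: connect_trans (IH _) _; first by lia.
  apply: connect_trans (layered_forward _ tx) _; first by lia.
  apply: connect_trans (layered_forward _ (tail_st _)) _; first by lia.
  rewrite /layer_step !ifF ?rho_inv //; lia.
apply: connect_trans (far h (leqnn h)) _.
apply: connect_trans (layered_forward _ tx) _; first by lia.
apply: connect_trans (layered_forward _ (tail_st _)) _; first by lia.
rewrite /layer_step -Th iter_card Th !eqxx.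
by rewrite ifF //; lia.
Qed.

Lemma layered_spanning : spanning layered.
Proof.
apply: (spanning_to (x0 := (t0, x0))) => // -[t x].
apply: connect_trans (layered_st t x) _.
(* Every point first runs to layer [t0], by induction on the number [d] of layers still to cross;
   whole laps then lead to [x0] by [base]. *)
have [y ty] : exists2 y, ~~ tail y & fconnect layered (t, st x) (t0, y).
  move: (st x) (tail_st x) => {}x tx; rewrite -(iter_pos t).
  have [d dE] : exists d, pos t + d = #|T|.
    by exists (#|T| - pos t); have := pos_lt t; lia.
  elim: d (pos t) dE x tx => [|d IH] i iE x tx.
    by exists x => //; rewrite addn0 in iE; rewrite iE iter_card.
  have [|y ty yP] := IH i.+1 _ (st (layer_step i x)) (tail_st _); first by lia.
  exists y => //; apply: connect_trans yP.
  by apply: layered_forward => //; lia.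
move=> /connect_trans; apply; have := base ty.
move=> /iter_findex; move: (findex _ _ _) => i <-.
elim: i y ty => [|i IH] y ty //; rewrite iterSr.
apply: connect_trans (layered_lap ty) (IH _ _); exact: tail_st.
Qed.

End Layers.

(** * Decomposing the wreath product *)

Lemma ordS_spanning n : spanning (@ordS n).
Proof.
move=> x y; have E i : iter i (@ordS n) x = (x + i) %% n :> nat.
  elim: i => [|i IH] /=; first by rewrite addn0 modn_small.
  by rewrite IH -addn1 modnDml addn1 addnS.
suff <- : iter (n - x + y) (@ordS n) x = y by apply: fconnect_iter.
apply: val_inj; rewrite /= E addnA subnKC; last by have := ltn_ord x; lia.
by rewrite modnDl modn_small.
Qed.

(** The first clause keeps colours disjoint. The other two make each colour injective on the whole
    digraph: the third rules out a vertex entered both from the previous layer and inside its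
    own. *)
Definition proper_transition (m : nat) (K : finType) (w : 'I_m -> K)
    (tau : K -> 'I_m -> 'I_m) : Prop :=
  [/\ forall x k l, w x != k -> w x != l -> tau k x = tau l x -> k = l,
      forall k x y, w x != k -> w y != k -> tau k x = tau k y -> x = y
    & forall k x y, w x != k -> w y = k -> tau k x != ordS y].

(* [kit_w x] is the colour of the in-layer arc leaving [x]; for a colour [k],
   [kit_st k] follows in-layer arcs until the layer can be left.  The last two
   transitions are [kit_s1] and [kit_s2], all others are [kit_rho]. *)
Record layer_kit (m : nat) (K : finType) : Type := LayerKit {
  kit_w : 'I_m -> K;
  kit_st : K -> 'I_m -> 'I_m;
  kit_s1 : K -> 'I_m -> 'I_m;
  kit_s2 : K -> 'I_m -> 'I_m;
  kit_rho : K -> 'I_m -> 'I_m;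
  kit_x0 : K -> 'I_m;
  kit_s1P : proper_transition kit_w kit_s1;
  kit_s2P : proper_transition kit_w kit_s2;
  kit_rhoP : proper_transition kit_w kit_rho;
  kit_st_exit : forall k x, kit_w (kit_st k x) != k;
  kit_st_path : forall k x, exists2 i, kit_st k x = iter i (@ordS m) x
    & forall j, j < i -> kit_w (iter j (@ordS m) x) == k;
  kit_rho_inv : forall k x, kit_w x != k ->
    kit_st k (kit_rho k (kit_st k (kit_rho k x))) = x;
  kit_base : forall k x, kit_w x != k ->
    fconnect (kit_st k \o kit_s2 k \o kit_st k \o kit_s1 k) x (kit_x0 k)
}.

(** The [m] colours other than [w x] leave [x] along distinct arcs, and there are only [m]
    targets. *)
Lemma proper_transition_onto (m : nat) (K : finType) (w : 'I_m -> K) tau x y :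
  #|K| = m.+1 -> proper_transition w tau -> exists2 k, w x != k & tau k x = y.
Proof.
move=> cK [tI _ _].
have inj : {in [set~ w x] &, injective (tau^~ x)}.
  by move=> k l; rewrite !inE ![_ == w x]eq_sym; apply: tI.
have : y \in [set tau k x | k in [set~ w x]].
  have /eqP -> : [set tau k x | k in [set~ w x]] == [set: 'I_m].
    by rewrite eqEcard subsetT /= card_in_imset // cardsC1 cK cardsT card_ord.
  by rewrite inE.
by case/imsetP=> k; rewrite !inE eq_sym => kw ->; exists k.
Qed.

(** * Factors lifted from the chosen cycle of [G] *)

Section KitFactors.
Variables (m : nat) (K : finType) (kit : layer_kit m K).
Hypothesis cK : #|K| = m.+1.
Variables (T : finType) (phi : T -> T) (t0 : T).
Hypotheses (sphi : spanning phi) (T_even : ~~ odd #|T|).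

Definition kit_factor (k : K) : T * 'I_m -> T * 'I_m :=
  layered phi t0 (fun x => kit_w kit x == k) (@ordS m)
    (kit_s1 kit k) (kit_s2 kit k) (kit_rho kit k).

Lemma kit_stepP i : proper_transition (kit_w kit)
  (fun k => layer_step T (kit_s1 kit k) (kit_s2 kit k) (kit_rho kit k) i).
Proof.
rewrite /layer_step; case: (_ == _); first exact: kit_s2P.
by case: (_ == _); [apply: kit_s1P|apply: kit_rhoP].
Qed.

Lemma kit_factor_spanning k : spanning (kit_factor k).
Proof.
apply: (@layered_spanning _ _ _ sphi _ _ _ (kit_st kit k)
  _ _ _ _ _ T_even _ _ (kit_x0 kit k)).
- exact: kit_st_exit.
- exact: kit_st_path.
- exact: kit_rho_inv.
- move=> [t x] [t' x']; rewrite /layered /=.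
  have [_ sI sN] := kit_stepP (findex phi t0 t).
  have [_ _ sN'] := kit_stepP (findex phi t0 t').
  case: ifPn => wx; case: ifPn => wx' /eqP;
    rewrite xpair_eqE => /andP[/eqP + /eqP].
  + by move=> -> /(@ordS_inj m) ->.
  + by move=> _ E; have := sN' k x' x wx' (eqP wx); rewrite -E eqxx.
  + by move=> _ E; have := sN k x x' wx (eqP wx'); rewrite E eqxx.
  + by move=> /(spanning_inj sphi) tt'; subst t'; move/(sI k x x' wx wx') => ->.
- exact: kit_base.
Qed.

Lemma kit_factor1 k p : (kit_factor k p).1 = p.1 \/ (kit_factor k p).1 = phi p.1.
Proof. by rewrite /kit_factor /layered; case: ifP; [left|right]. Qed.

Hypothesis phi_irr : forall t, phi t != t.

Lemma kit_factor_inj p : injective (kit_factor^~ p).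
Proof.
case: p => t x k l; rewrite /kit_factor /layered /=.
have [sI _ _] := kit_stepP (findex phi t0 t).
case: ifPn => wk; case: ifPn => wl /eqP;
  rewrite xpair_eqE => /andP[/eqP + /eqP].
- by rewrite -(eqP wk) -(eqP wl).
- by move=> E; have := phi_irr t; rewrite -E eqxx.
- by move=> E; have := phi_irr t; rewrite E eqxx.
- by move=> _; apply: sI.
Qed.

Lemma kit_factor_vertical t x :
  kit_factor (kit_w kit x) (t, x) = (t, ordS x).
Proof. by rewrite /kit_factor /layered /= eqxx. Qed.

Lemma kit_factor_forward t x y : exists k, kit_factor k (t, x) = (phi t, y).
Proof.
have [k kw <-] := proper_transition_onto x y cK (kit_stepP (findex phi t0 t)).
by exists k; rewrite /kit_factor /layered /= (negbTE kw).
Qed.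

End KitFactors.

(** * Factors lifted from the other cycles of [G] *)

Section Reflections.
Variables (m : nat) (T : finType) (psi : T -> T) (t0 : T).
Hypotheses (spsi : spanning psi) (T_even : ~~ odd #|T|).
Local Open Scope ring_scope.

Definition reflection_factor (j : 'I_m.+1) : T * 'I_m.+1 -> T * 'I_m.+1 :=
  @layered T psi t0 'I_m.+1 pred0 id (fun x => j - x)
    (fun x => ordS (j - x)) (fun x => j - x).

Lemma reflection_stepE j i x :
  @layer_step T 'I_m.+1 (fun x => j - x) (fun x => ordS (j - x))
    (fun x => j - x) i x
  = if (i.+1 == #|T|)%N then ordS (j - x) else j - x.
Proof. by rewrite /layer_step; case: ifP => // _; case: ifP. Qed.

(** Reflections are involutions, so a lap over an even number of layers reduces to the twist [ordS],
    a single cycle on the layer. *)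
Lemma reflection_factor_spanning j : spanning (reflection_factor j).
Proof.
apply: (@layered_spanning _ _ _ spsi _ _ _ id _ _ _ _ _ T_even _ _ ord0) => //.
- by move=> x; exists 0%N.
- by move=> x _ /=; rewrite GRing.subKr.
- move=> [t x] [t' x']; rewrite /layered /= => /eqP.
  rewrite xpair_eqE !reflection_stepE => /andP[/eqP/(spanning_inj spsi) <-].
  by case: ifP => _ /eqP; [move/(@ordS_inj m.+1)|]; move/(@GRing.subrI _ j) => ->.
- move=> x _; rewrite (@eq_fconnect _ _ (@ordS m.+1)); first exact: ordS_spanning.
  by move=> y /=; rewrite GRing.subKr.
Qed.

Lemma reflection_factor1 j p : (reflection_factor j p).1 = psi p.1.
Proof. by []. Qed.

Lemma reflection_factor_inj p : injective (reflection_factor^~ p).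
Proof.
case: p => t x j l; rewrite /reflection_factor /layered /= => /eqP.
rewrite xpair_eqE !reflection_stepE => /andP[_].
by case: ifP => _ /eqP; [move/(@ordS_inj m.+1)|]; move/(@GRing.addIr _ (- x)).
Qed.

Lemma reflection_factor_forward t x y :
  exists j, reflection_factor j (t, x) = (psi t, y).
Proof.
rewrite /reflection_factor /layered /=.
case E: ((findex psi t0 t).+1 == #|T|)%N.
  exists (ord_pred y + x); rewrite reflection_stepE E.
  by rewrite GRing.addrK ord_predK.
by exists (y + x); rewrite reflection_stepE E GRing.addrK.
Qed.

End Reflections.

(** The kit is laid over one cycle [l0] of [G] and absorbs all in-layer arcs; every other cycle of
    [G] is lifted by reflections. *)
Theorem kit_wreath_decomposable (m : nat) (K : finType) (T : finType)
    (G : rel T) :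
  0 < m -> #|K| = m.+1 -> layer_kit m K -> irreflexive G -> ~~ odd #|T| ->
  hamiltonian_decomposable G -> hamiltonian_decomposable (wreath G (@dicycle m)).
Proof.
case: m => // m _ cK kit irrG T_even /decomposable_factorization.
case=> T1 [L [l0 [f [sf fI fG]]]].
have t0 : T by case: (pickP T) T1 => // /eq_card0 ->.
have Gf l t : G t (f l t) by rewrite fG; apply/existsP; exists l.
have f_irr l t : f l t != t by apply/eqP => E; have := Gf l t; rewrite E irrG.
have k0 : K := kit_w kit ord0.
pose F (c : K + {l | l != l0} * 'I_m.+1) : T * 'I_m.+1 -> T * 'I_m.+1 :=
  match c with
  | inl k => kit_factor kit (f l0) t0 k
  | inr (l, j) => reflection_factor (f (val l)) t0 j
  end.
apply: (factorization_decomposable (inl k0) (f := F)).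
  by rewrite card_prod card_ord; nia.
split.
- case=> [k|[l j]] /=; first exact: kit_factor_spanning.
  exact: reflection_factor_spanning.
(* A kit factor stays in its layer or follows [f l0], while a reflection factor follows another
   cycle of [G]. *)
- have cross k (l : {l | l != l0}) j p :
      kit_factor kit (f l0) t0 k p <> reflection_factor (f (val l)) t0 j p.
    move=> /(congr1 fst); rewrite reflection_factor1.
    case: (kit_factor1 kit (f l0) t0 k p) => -> E.
      by have := f_irr (val l) p.1; rewrite -E eqxx.
    by have := valP l; rewrite -(fI _ _ _ E) eqxx.
  move=> p [k|[l j]] [k'|[l' j']] //= E.
  + by congr inl; apply: kit_factor_inj E; auto.
  + by case: (cross _ _ _ _ E).
  + by case: (cross _ _ _ _ (esym E)).
  + have : f (val l) p.1 = f (val l') p.1.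
      by rewrite -(reflection_factor1 (f (val l)) t0 j) E.
    move/fI/val_inj => El; subst l'.
    by rewrite (reflection_factor_inj E).
- move=> [t x] [t' y]; rewrite /wreath /dicycle /=; apply/orP/existsP.
  + case=> [|/andP[/eqP <- /eqP ->]].
      rewrite fG => /existsP[l /eqP <-].
      have [->|ll0] := eqVneq l l0.
        have [k <-] := kit_factor_forward kit cK (f l0) t0 t x y.
        by exists (inl k).
      have [j <-] := reflection_factor_forward (f l) t0 t x y.
      by exists (inr (exist _ l ll0, j)).
    by exists (inl (kit_w kit x)); rewrite /= kit_factor_vertical.
  + case=> -[k|[l j]] /= /eqP; rewrite /kit_factor /reflection_factor /layered /=.
      by case: ifP => _ [<- <-]; [right; rewrite !eqxx|left; apply: Gf].
    by case=> <- _; left; apply: Gf.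
Qed.

(** * Explicit tables for small layers *)

Section Tables.
Variables (m' : nat) (w : seq nat) (t1 t2 t3 : seq (seq nat)).
Let m := m'.+1.

(** Row [k] of a table belongs to colour [k]; an entry at a vertex whose in-layer arc has colour [k]
    is a filler and only has to be in range. *)
Definition table_fun (t : seq (seq nat)) (k x : nat) : nat :=
  nth 0 (nth [::] t k) x.

Definition below (n : nat) (P : pred nat) : bool := all P (iota 0 n).

Lemma belowP n (P : pred nat) i : below n P -> i < n -> P i.
Proof. by move=> /allP nP ii; apply: nP; rewrite mem_iota. Qed.

Definition table_exit (k x : nat) : bool := nth 0 w x != k.

(** [m] rounds suffice to leave any run of in-layer arcs that does not fill the layer. *)
Definition table_settle (k : nat) : nat -> nat :=
  iter m (fun y => if table_exit k y then y else y.+1 %% m).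

Definition proper_table (t : seq (seq nat)) : bool :=
  below m (fun x => (nth 0 w x < m.+1) && below m.+1 (fun k =>
    [&& table_fun t k x < m,
        table_exit k x ==> below m.+1 (fun l => table_exit l x ==>
          (table_fun t k x == table_fun t l x) ==> (k == l)),
        table_exit k x ==> below m (fun y => table_exit k y ==>
          (table_fun t k x == table_fun t k y) ==> (x == y))
      & table_exit k x ==> below m (fun y => ~~ table_exit k y ==>
          (table_fun t k x != y.+1 %% m))])).

Definition table_lap (k : nat) : nat -> nat :=
  table_settle k \o table_fun t2 k \o table_settle k \o table_fun t1 k.

Definition table_return (k : nat) : nat -> nat :=
  table_settle k \o table_fun t3 k \o table_settle k \o table_fun t3 k.

Definition table_target (k : nat) : nat := find (table_exit k) (iota 0 m).

Definition kit_tables : bool :=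
  [&& proper_table t1, proper_table t2, proper_table t3
    & below m.+1 (fun k => [&& table_target k < m &
        below m (fun x => table_exit k (table_settle k x) &&
          (table_exit k x ==> [&& table_return k x == x
             & table_target k \in traject (table_lap k) x m]))])].

Hypothesis kitP : kit_tables.

Definition table_w (x : 'I_m) : 'I_m.+1 := inord (nth 0 w x).
Definition table_map (t : seq (seq nat)) (k : 'I_m.+1) (x : 'I_m) : 'I_m :=
  inord (table_fun t k x).
Definition table_st (k : 'I_m.+1) : 'I_m -> 'I_m :=
  iter m (fun y => if table_w y != k then y else ordS y).

Lemma table_wE t (k : 'I_m.+1) (x : 'I_m) : proper_table t ->
  (table_w x != k) = table_exit k x.
Proof.
move=> /belowP /(_ (ltn_ord x)) /andP[wx _].
by rewrite /table_w /table_exit -val_eqE /= inordK.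
Qed.

Lemma table_proper t : proper_table t -> proper_transition table_w (table_map t).
Proof.
move=> tP; have wE := table_wE _ _ tP.
have tE k x : val (table_map t k x) = table_fun t k x.
  have /andP[_ /belowP /(_ (ltn_ord k)) /and4P[tx _ _ _]] :=
    belowP tP (ltn_ord x).
  by rewrite /table_map /= inordK.
split=> [x k l|k x y|k x y]; rewrite ?wE => kx.
- move=> lx /(congr1 val); rewrite !tE => E; apply: val_inj.
  have /andP[_ /belowP /(_ (ltn_ord k)) /and4P[_ + _ _]] := belowP tP (ltn_ord x).
  by rewrite kx /= => /belowP /(_ (ltn_ord l)); rewrite lx E eqxx => /eqP.
- move=> ky /(congr1 val); rewrite !tE => E; apply: val_inj.
  have /andP[_ /belowP /(_ (ltn_ord k)) /and4P[_ _ + _]] := belowP tP (ltn_ord x).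
  by rewrite kx /= => /belowP /(_ (ltn_ord y)); rewrite ky E eqxx => /eqP.
- move=> /eqP; rewrite -[_ == _]negbK wE => ky; rewrite -val_eqE tE /=.
  have /andP[_ /belowP /(_ (ltn_ord k)) /and4P[_ _ _]] := belowP tP (ltn_ord x).
  by rewrite kx /= => /belowP /(_ (ltn_ord y)); rewrite ky.
Qed.

(** The tests run on natural numbers, where they evaluate; they also keep every [inord] of the
    transfer to ordinals in range. *)
Lemma table_kit : layer_kit m 'I_m.+1.
Proof.
have /and4P[p1 p2 p3 bP] := kitP.
have wE := table_wE _ _ p1.
have tE t (k : 'I_m.+1) (x : 'I_m) : proper_table t ->
    val (table_map t k x) = table_fun t k x.
  move=> tP.
  have /andP[_ /belowP /(_ (ltn_ord k)) /and4P[tx _ _ _]] :=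
    belowP tP (ltn_ord x).
  by rewrite /table_map /= inordK.
have stE (k : 'I_m.+1) (x : 'I_m) : val (table_st k x) = table_settle k x.
  have gen n : iter n (fun y => if table_w y != k then y else ordS y) x =
      iter n (fun y => if table_exit k y then y else y.+1 %% m) x :> nat.
    by elim: n => //= n <-; rewrite wE; case: ifP.
  exact: gen.
pose x0 (k : 'I_m.+1) : 'I_m := inord (table_target k).
apply: (@LayerKit _ _ table_w table_st (table_map t1) (table_map t2)
  (table_map t3) x0); try exact: table_proper.
- move=> k x; have /andP[_ /belowP /(_ (ltn_ord x)) /andP[]] := belowP bP (ltn_ord k).
  by rewrite wE stE.
- move=> k x; suff gen n : exists2 i,
      iter n (fun y => if table_w y != k then y else ordS y) x
      = iter i (@ordS m) x & forall j, j < i -> table_w (iter j (@ordS m) x) == k.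
    exact: gen.
  elim: n => [|n [i E tl]]; first by exists 0.
  rewrite iterS E; case: ifPn => [_|]; first by exists i.
  rewrite negbK => wi; exists i.+1 => // j; rewrite ltnS leq_eqVlt.
  by case/predU1P => [->//|/tl].
- move=> k x; rewrite wE => kx; apply: val_inj.
  have /andP[_ /belowP /(_ (ltn_ord x)) /andP[_]] := belowP bP (ltn_ord k).
  by rewrite kx /= => /andP[/eqP <- _]; rewrite /table_return /= stE tE // stE tE.
- move=> k x; rewrite wE => kx.
  have /andP[k0 /belowP /(_ (ltn_ord x)) /andP[_]] := belowP bP (ltn_ord k).
  rewrite kx implyTb => /andP[_ /trajectP[i _ E]].
  suff <- : iter i (table_st k \o table_map t2 k \o table_st k \o table_map t1 k) x
            = x0 k by apply: fconnect_iter.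
  apply: val_inj; rewrite /= inordK // E; elim: i {E} => //= i <-.
  by rewrite /table_lap /= stE tE // stE tE.
Qed.

End Tables.

(** Three colours share the in-layer arcs here: [0] has two of them, [1] and [2] have one each. *)
Lemma layer_kit4 : layer_kit 4 'I_5.
Proof.
exact: (@table_kit 3 [:: 0; 1; 2; 0]
  [:: [:: 0; 2; 3; 0]; [:: 0; 0; 1; 3]; [:: 1; 0; 0; 2]; [:: 2; 3; 0; 1];
      [:: 3; 1; 2; 0]]
  [:: [:: 0; 3; 2; 0]; [:: 3; 0; 0; 1]; [:: 2; 1; 0; 0]; [:: 0; 2; 1; 3];
      [:: 1; 0; 3; 2]]
  [:: [:: 0; 3; 2; 0]; [:: 0; 0; 3; 1]; [:: 1; 0; 0; 2]; [:: 2; 1; 0; 3];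
      [:: 3; 2; 1; 0]]).
Qed.

(** As in the general construction, colour [5] runs through the layer, colour [4] takes the arc
    [4 -> 0], and the last table is [j - x] for the colours [j] up to [4]. *)
Lemma layer_kit5 : layer_kit 5 'I_6.
Proof.
exact: (@table_kit 4 [:: 5; 5; 5; 5; 4]
  [:: [:: 0; 2; 1; 4; 3]; [:: 1; 0; 3; 2; 4]; [:: 2; 3; 4; 0; 1];
      [:: 3; 4; 0; 1; 2]; [:: 4; 1; 2; 3; 0]; [:: 0; 0; 0; 0; 0]]
  [:: [:: 3; 4; 0; 1; 2]; [:: 2; 3; 4; 0; 1]; [:: 0; 1; 2; 3; 4];
      [:: 4; 0; 1; 2; 3]; [:: 1; 2; 3; 4; 0]; [:: 0; 0; 0; 0; 0]]
  [:: [:: 0; 4; 3; 2; 1]; [:: 1; 0; 4; 3; 2]; [:: 2; 1; 0; 4; 3];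
      [:: 3; 2; 1; 0; 4]; [:: 4; 3; 2; 1; 0]; [:: 0; 0; 0; 0; 0]]).
Qed.

Lemma layer_kit6 : layer_kit 6 'I_7.
Proof.
exact: (@table_kit 5 [:: 6; 6; 6; 6; 6; 5]
  [:: [:: 1; 0; 4; 5; 3; 2]; [:: 2; 1; 3; 0; 4; 5]; [:: 0; 2; 5; 3; 1; 4];
      [:: 4; 3; 0; 2; 5; 1]; [:: 5; 4; 2; 1; 0; 3]; [:: 3; 5; 1; 4; 2; 0];
      [:: 0; 0; 0; 0; 0; 0]]
  [:: [:: 4; 1; 0; 3; 5; 2]; [:: 0; 2; 1; 5; 3; 4]; [:: 1; 5; 2; 4; 0; 3];
      [:: 3; 0; 4; 2; 1; 5]; [:: 5; 4; 3; 0; 2; 1]; [:: 2; 3; 5; 1; 4; 0];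
      [:: 0; 0; 0; 0; 0; 0]]
  [:: [:: 0; 5; 4; 3; 2; 1]; [:: 1; 0; 5; 4; 3; 2]; [:: 2; 1; 0; 5; 4; 3];
      [:: 3; 2; 1; 0; 5; 4]; [:: 4; 3; 2; 1; 0; 5]; [:: 5; 4; 3; 2; 1; 0];
      [:: 0; 0; 0; 0; 0; 0]]).
Qed.

(** * Hall's theorem and regular bipartite graphs *)

Section Hall.
Variables (X Y : finType) (y0 : Y).

(** Induction on [#|A|]: a nonempty proper subset without spare neighbours is matched first and the
    rest afterwards; if there is none, any single edge can be split off. *)
Theorem hall_marriage (N : X -> {set Y}) (A : {set X}) :
  (forall B : {set X}, B \subset A -> #|B| <= #|\bigcup_(x in B) N x|) ->
  exists f : X -> Y, {in A, forall x, f x \in N x} /\ {in A &, injective f}.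
Proof.
move: {2}#|A| (leqnn #|A|) => n; elim: n N A => [|n IH] N A An hallA.
  have -> : A = set0 by apply/eqP; rewrite -cards_eq0 -leqn0.
  by exists (fun=> y0); split=> [x|x ?]; rewrite inE.
have [->|[a aA]] := set_0Vmem A.
  by exists (fun=> y0); split=> [x|x ?]; rewrite inE.
pose tight (B : {set X}) :=
  [&& B \proper A, B != set0 & #|\bigcup_(x in B) N x| <= #|B|].
case: (pickP tight) => [B0 /and3P[B0A B0n0 B0t]|loose].
  have [sB0A cB0] := (proper_sub B0A, proper_card B0A).
  set Z := \bigcup_(x in B0) N x in B0t.
  have [|B sB|f1 [f1N f1I]] := IH N B0; first by lia.
    exact: hallA (subset_trans sB sB0A).
  have [||f2 [f2N f2I]] := IH (fun x => N x :\: Z) (A :\: B0).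
  - by rewrite cardsD (setIidPr sB0A); move: B0n0; rewrite -card_gt0; lia.
  - move=> B; rewrite subsetD => /andP[sBA dB].
    (* Hall's condition for [B :|: B0], less the tight set [B0] and its neighbourhood [Z], is the
       condition for [B] outside [Z]. *)
    have := hallA (B :|: B0); rewrite subUset sBA sB0A => /(_ isT).
    rewrite bigcup_setU -/Z cardsU (disjoint_setI0 dB) cards0 subn0.
    have -> : \bigcup_(x in B) N x :|: Z =
              Z :|: \bigcup_(x in B) (N x :\: Z).
      apply/setP => y; rewrite !inE; have [yZ|yZ] /= := boolP (y \in Z).
        by rewrite orbT.
      rewrite orbF; apply/bigcupP/bigcupP => -[x xB].
        by move=> yN; exists x => //; rewrite inE yZ.
      by rewrite inE yZ => yN; exists x.
    by rewrite cardsU; lia.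
  exists (fun x => if x \in B0 then f1 x else f2 x); split=> [x xA|x x' xA x'A].
    have [/f1N //|xB0] := boolP (x \in B0).
    by have := f2N x; rewrite !inE xB0 xA => /(_ isT) /andP[].
  have out u v : u \in A -> u \notin B0 -> v \in B0 -> f2 u != f1 v.
    move=> uA uB vB; apply/eqP => fuv.
    have := f2N u; rewrite !inE uB uA => /(_ isT) /andP[/negP nZ _]; apply: nZ.
    by rewrite fuv; apply/bigcupP; exists v => //; apply: f1N.
  case: ifPn => xB; case: ifPn => xB' eqf.
  - exact: f1I.
  - by have := out _ _ x'A xB' xB; rewrite eqf eqxx.
  - by have := out _ _ xA xB xB'; rewrite eqf eqxx.
  - by apply: f2I; rewrite ?inE ?xB ?xB'.
have /card_gt0P[y ya] : 0 < #|N a|.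
  have := hallA [set a]; rewrite sub1set aA cards1 big_set1; exact.
have [||f [fN fI]] := IH (fun x => N x :\ y) (A :\ a).
- by rewrite (cardsD1 a) aA in An.
- move=> B sB; have [->|B0] := eqVneq B set0; first by rewrite cards0.
  have sBA : B \proper A.
    apply: sub_proper_trans sB _; apply/properP; split; first exact: subsetDl.
    by exists a => //; rewrite !inE eqxx.
  (* As [B] is not tight, it has a spare neighbour and can afford to lose [y]. *)
  have := loose B; rewrite /tight sBA B0 /= => /negbT; rewrite -ltnNge => ltB.
  have -> : \bigcup_(x in B) (N x :\ y) = (\bigcup_(x in B) N x) :\ y.
    apply/setP => z; rewrite !inE; apply/bigcupP/andP => [[x xB]|[zy]].
      by rewrite !inE => /andP[zy zx]; split=> //; apply/bigcupP; exists x.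
    by case/bigcupP => x xB zx; exists x; rewrite // !inE zy.
  by have := cardsD1 y (\bigcup_(x in B) N x); case: (y \in _) => /=; lia.
have fy x : x \in A -> x != a -> f x \in N x /\ f x != y.
  by move=> xA xa; have := fN x; rewrite !inE xA xa => /(_ isT) /andP[].
exists (fun x => if x == a then y else f x); split=> [x xA|x x' xA x'A].
  by have [->//|xa] := eqVneq x a; case: (fy x).
have [->|xa] := eqVneq x a; have [->|xa'] := eqVneq x' a => // eqf.
- by case: (fy _ x'A xa') => _; rewrite eqf eqxx.
- by case: (fy _ xA xa) => _; rewrite eqf eqxx.
- by apply: fI; rewrite ?inE ?xa ?xa'.
Qed.

End Hall.

(** Regularity gives Hall's condition; removing the resulting perfect matching lowers the degree by
    one. *)
Theorem regular_bipartite_decomposition (U : finType) (d : nat) (e : rel U) :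
  (forall x, #|[set y | e x y]| = d) -> (forall y, #|[set x | e x y]| = d) ->
  exists p : nat -> {perm U},
    (forall i x, i < d -> e x (p i x)) /\
    (forall i j x, i < d -> j < d -> p i x = p j x -> i = j).
Proof.
elim: d e => [|d IH] e er ec.
  by exists (fun=> 1%g); split.
case: (pickP U) => [y0 _|U0]; last first.
  by exists (fun=> 1%g); split=> [i x|i j x]; have := U0 x.
have hallU (B : {set U}) : B \subset [set: U] ->
    #|B| <= #|\bigcup_(x in B) [set y | e x y]|.
  (* [#|B| * d.+1] arcs leave [B], and each neighbour receives at most [d.+1] of them. *)
  move=> _; rewrite -(leq_pmul2r (ltn0Sn d)).
  have -> : #|B| * d.+1 = \sum_(x in B) \sum_(y | e x y) 1.
    rewrite -sum_nat_const; apply: eq_bigr => x _.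
    by rewrite sum1dep_card er.
  rewrite -sum_nat_const (exchange_big_dep
    (mem (\bigcup_(x in B) [set y | e x y]))) /=; last first.
    by move=> x y xB exy; apply/bigcupP; exists x; rewrite // inE.
  apply: leq_sum => y _; rewrite sum1dep_card -(ec y).
  by apply: subset_leq_card; apply/subsetP => x; rewrite !inE => /andP[].
have [f [fe fI]] := hall_marriage y0 hallU.
have {}fI : injective f by move=> x x'; apply: fI; rewrite inE.
have {}fe x : e x (f x) by have := fe x; rewrite !inE; apply.
pose q := perm fI; have qE x : q x = f x by rewrite permE.
have [||p [pe pI]] := IH (fun x y => e x y && (y != q x)).
- move=> x; have := cardsD1 (q x) [set y | e x y]; rewrite er inE qE fe.
  by case=> ->; apply: eq_card => y; rewrite !inE andbC.
- move=> y; have eqy : e (q^-1 y)%g y by have := fe (q^-1 y)%g; rewrite -qE permKV.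
  have := cardsD1 (q^-1 y)%g [set x | e x y]; rewrite ec inE eqy => -[->].
  apply: eq_card => x; rewrite !inE andbC.
  by congr (~~ _ && _); rewrite eq_sym (can2_eq (permK q) (permKV q)).
exists (fun i => if i is i'.+1 then p i' else q); split.
  by case=> [|i] x id; [rewrite qE fe|case/andP: (pe i x id)].
move=> [|i] [|j] x id jd //.
- by move=> /esym/eqP pq; case/andP: (pe j x jd); rewrite pq.
- by move=> /eqP pq; case/andP: (pe i x id); rewrite pq.
- by move/pI => ->.
Qed.

(** * Pairs of Latin squares *)

Section LatinKit.
Variable (m : nat).
Local Notation I := 'I_m.+1.
Variables (s1 s2 : I -> I -> I).

Definition latin (s : I -> I -> I) : Prop :=
  (forall j, injective (s j)) /\ (forall x, injective (s^~ x)).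

Hypotheses (L1 : latin s1) (L2 : latin s2).
Hypotheses (s1_max : s1 ord_max ord_max = ord0).
Hypotheses (s2_max : s2 ord_max ord_max = ord0).

(* Colour [None] runs through a whole layer, from 0 to [ord_max]; colour
   [Some ord_max] uses the remaining in-layer arc [ord_max -> 0]. *)
Definition latin_w (x : I) : option I :=
  if x == ord_max then Some ord_max else None.

Definition latin_st (k : option I) (x : I) : I :=
  if k is Some j then if (j == ord_max) && (x == ord_max) then ord0 else x
  else ord_max.

(** The arc [ord_max -> 0] of row [ord_max] is free, as that colour stays in the layer at [ord_max];
    colour [None], which leaves only from [ord_max], takes it. *)
Definition latin_map (s : I -> I -> I) (k : option I) (x : I) : I :=
  if k is Some j then s j x else ord0.

Variable x0 : I -> I.
Hypothesis rows : forall j x, j != ord_max -> fconnect (s2 j \o s1 j) x (x0 j).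
Hypothesis last_row : forall x, x != ord_max ->
  fconnect (latin_st (Some ord_max) \o s2 ord_max \o latin_st (Some ord_max)
            \o s1 ord_max) x (x0 ord_max).

Hypothesis m_gt0 : 0 < m.

Lemma ordS_eq0 (x : I) : (ordS x == ord0) = (x == ord_max).
Proof.
rewrite -!val_eqE /=; have := ltn_ord x; rewrite ltnS leq_eqVlt.
case/predU1P => [->|xm]; first by rewrite modnn !eqxx.
have -> : x.+1 %% m.+1 = x.+1 by rewrite modn_small.
by rewrite (ltn_eqF xm).
Qed.

Lemma latin_w_None (x : I) : (latin_w x != None) = (x == ord_max).
Proof. by rewrite /latin_w; case: (x == _). Qed.

Lemma latin_w_Some (x j : I) :
  (latin_w x != Some j) = ~~ ((x == ord_max) && (j == ord_max)).
Proof.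
rewrite /latin_w; case: (x =P _) => //= _.
by rewrite [j == _]eq_sym; congr (~~ _).
Qed.

Lemma latin_proper (s : I -> I -> I) : latin s -> s ord_max ord_max = ord0 ->
  proper_transition latin_w (latin_map s).
Proof.
move=> [sI sJ] smax; split.
- have none (x l : I) : latin_w x != None -> latin_w x != Some l ->
      s l x <> ord0.
    rewrite latin_w_None latin_w_Some => /eqP ->; rewrite eqxx /= => lm.
    by rewrite -smax => /sJ/eqP; apply/negP.
  move=> x [k|] [l|] //= wk wl E.
  + by rewrite (sJ x _ _ E).
  + by case: (none x k wl wk).
  + by case: (none x l wk wl).
- move=> [j|] x y /=; first by move=> _ _ /sI.
  by rewrite !latin_w_None => /eqP -> /eqP ->.
- move=> [j|] x y /=.
    (* The in-layer arc of colour [Some ord_max] ends at [ord0], which row [ord_max] hits only from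
       [ord_max] itself. *)
    rewrite latin_w_Some => wx /eqP; rewrite -[_ == _]negbK latin_w_Some negbK.
    case/andP=> /eqP-> /eqP jm; move: wx; rewrite jm eqxx andbT => xm.
    have /eqP -> : ordS (@ord_max m) == ord0 by rewrite ordS_eq0.
    by rewrite -smax (inj_eq (sI _)).
  move=> _ /eqP; rewrite -[_ == _]negbK latin_w_None => ym.
  by rewrite eq_sym ordS_eq0.
Qed.

Lemma latin_kit : layer_kit m.+1 (option I).
Proof.
pose rho (j x : I) : I := (j - x)%R.
have max1 : (ord_max - ord_max = ord0 :> I)%R by rewrite GRing.subrr.
have rhoL : latin rho.
  by split=> [j|x]; [apply: GRing.subrI|apply: GRing.addIr].
have neq0 : ord0 != ord_max :> I by rewrite -val_eqE /=; lia.
apply: (@LayerKit _ _ latin_w latin_st (latin_map s1) (latin_map s2)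
  (latin_map rho) (fun k => if k is Some j then x0 j else ord_max)).
- exact: latin_proper.
- exact: latin_proper.
- exact: latin_proper.
- move=> [j|] x; rewrite ?latin_w_Some ?latin_w_None //= ?eqxx //.
  by case: ifPn; [rewrite (negbTE neq0)|rewrite andbC].
- move=> [j|] x /=.
    case: ifPn => [/andP[/eqP -> /eqP ->]|]; last by exists 0.
    exists 1; first by apply/esym/eqP; rewrite ordS_eq0.
    by case=> // _; rewrite /latin_w /= eqxx.
  have E i : i <= m - x -> iter i (@ordS m.+1) x = x + i :> nat.
    elim: i => [|i IH] im; first by rewrite addn0.
    by rewrite iterS /= IH ?modn_small; lia.
  have xm := leq_ord x; exists (m - x).
    by apply: val_inj; rewrite /= E // subnKC.
  move=> i im; rewrite -[_ == _]negbK latin_w_None -val_eqE /= E; lia.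
- move=> [j|] x /=; last first.
    by rewrite latin_w_None => /eqP.
  rewrite latin_w_Some negb_and /rho; have [->|jm] := eqVneq j ord_max => /=.
    (* Only [x = 0] is reflected to [ord_max]; settling then leads back to [0], and the second round
       does the same. *)
    rewrite orbF => xm; have [y0|ym] := eqVneq (ord_max - x)%R ord_max.
      have -> : x = ord0.
        by apply: (@GRing.subrI _ (ord_max : I)); rewrite y0 GRing.subr0.
      by rewrite GRing.subr0 eqxx.
    by rewrite GRing.subKr (negbTE xm).
  by rewrite GRing.subKr.
- move=> [j|] x /=; last first.
    by rewrite latin_w_None => /eqP ->; rewrite (@eq_fconnect _ _ (fun=> ord_max)).
  rewrite latin_w_Some negb_and; have [->|jm _] := eqVneq j ord_max => /=.
    by rewrite orbF => /last_row.
  rewrite (@eq_fconnect _ _ (s2 j \o s1 j)); first exact: rows.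
  by move=> y /=; rewrite (negbTE jm).
Qed.
End LatinKit.

(** * Latin squares for large layers *)

(** [r] increases along the orbit and is bounded by [b], so the orbit must meet [x0], the only point
    of [P] where it may drop. *)
Lemma fconnect_potential (T : finType) (f : T -> T) (r : T -> nat) (b : nat)
    (P : pred T) (x0 : T) :
  (forall x, P x -> x != x0 -> P (f x) && (r x < r (f x) <= b)) ->
  forall x, P x -> fconnect f x x0.
Proof.
move=> rP x; have [n] := ubnP (b - r x); elim: n x => // n IH x xn Px.
have [->|xx0] := eqVneq x x0; first exact: connect0.
have /and3P[Pf rf fb] := rP x Px xx0.
by apply: connect_trans (fconnect1 _ _) (IH _ _ Pf); lia.
Qed.

Section Rows.
Variable h : nat.

(* Rows F, C, D of R0 in order m = h + 7; those of R are obtained by composing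
   with the transpositions below.  In the columns h + 2, ..., h + 6, rows F, C, D
   contain a 3-cycle on the symbols 0 and h + 6, and rows C, D an intercalate on
   h + 4 and h + 5; exchanging the symbols in both turns R0 into R. *)
Definition row_of (c : nat) (s : seq nat) (y : nat) : nat :=
  if y < h.+1 then y + c else nth 0 s (y - h.+1).

Definition rowF := row_of 2 [:: h + 4; 0; 1; h + 5; h + 3; h + 6].
Definition rowC := row_of 1 [:: h + 2; h + 6; h + 4; 0; h + 5; h + 3].
Definition rowD := row_of 3 [:: 1; 2; h + 5; h + 6; h + 4; 0].
Definition swapF := row_of 0 [:: h + 1; h + 6; h + 3; h + 4; h + 5; h + 2].
Definition swapC := row_of 0 [:: h + 1; h + 4; h + 5; h + 2; h + 3; h + 6].
Definition swapD := row_of 0 [:: h + 1; h + 2; h + 5; h + 6; h + 3; h + 4].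

(** Values come in the order F, C, D, then the three transpositions; goals about a column become
    linear arithmetic. *)
Variant column_spec (y : nat) : nat -> nat -> nat -> nat -> nat -> nat -> Type :=
| ColBulk of y < h.+1 : column_spec y (y + 2) (y + 1) (y + 3) y y y
| ColLast of y = h + 1 :
    column_spec y (h + 4) (h + 2) 1 (h + 1) (h + 1) (h + 1)
| Col2 of y = h + 2 : column_spec y 0 (h + 6) 2 (h + 6) (h + 4) (h + 2)
| Col4 of y = h + 3 :
    column_spec y 1 (h + 4) (h + 5) (h + 3) (h + 5) (h + 5)
| Col3 of y = h + 4 :
    column_spec y (h + 5) 0 (h + 6) (h + 4) (h + 2) (h + 6)
| Col5 of y = h + 5 :
    column_spec y (h + 3) (h + 5) (h + 4) (h + 5) (h + 3) (h + 3)
| Col1 of y = h + 6 :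
    column_spec y (h + 6) (h + 3) 0 (h + 2) (h + 6) (h + 4).

Lemma columnP y : y < h.+1.+2.+4 ->
  column_spec y (rowF y) (rowC y) (rowD y) (swapF y) (swapC y) (swapD y).
Proof.
move=> yh; rewrite /rowF /rowC /rowD /swapF /swapC /swapD /row_of.
have [y1|y1] := ltnP y h.+1; first by rewrite addn0; constructor.
have := subnKC y1; have : y - h.+1 < 6 by lia.
by move: (y - h.+1) => [|[|[|[|[|[|//]]]]]] _ E /=; constructor; lia.
Qed.

Local Notation N := h.+1.+2.+4.

Lemma rowF_inj : {in gtn N &, injective rowF}.
Proof. by move=> y z /columnP[] Hy /columnP[] Hz; lia. Qed.

Lemma rowC_inj : {in gtn N &, injective rowC}.
Proof. by move=> y z /columnP[] Hy /columnP[] Hz; lia. Qed.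

Lemma rowD_inj : {in gtn N &, injective rowD}.
Proof. by move=> y z /columnP[] Hy /columnP[] Hz; lia. Qed.

Lemma row_bound y : y < N ->
  [/\ rowF y < N, rowC y < N, rowD y < N, swapF y < N & swapC y < N /\ swapD y < N].
Proof. by case/columnP => Hy; split; lia. Qed.

Lemma row_distinct y : y < N ->
  [&& rowF y != rowC y, rowF y != rowD y & rowC y != rowD y].
Proof. by case/columnP => Hy; lia. Qed.

(** In every column the exchange only permutes the three entries, so the other rows of [R0] still
    complete the changed rows to a Latin square. *)
Lemma swap_distinct y : y < N ->
  [/\ rowF (swapF y) != rowC (swapC y), rowF (swapF y) != rowD (swapD y),
      rowC (swapC y) != rowD (swapD y) &
  [/\ rowF (swapF y) \in [:: rowF y; rowC y; rowD y],
      rowC (swapC y) \in [:: rowF y; rowC y; rowD y] &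
      rowD (swapD y) \in [:: rowF y; rowC y; rowD y]]].
Proof.
move=> yN; case: (row_bound yN) => _ _ _ sF [sC sD]; rewrite !inE.
move: sF sC sD; case: (columnP yN) => Hy.
all: do 3 case/columnP => ?; try lia.
all: by split; [lia..|split; lia].
Qed.

Local Notation I := 'I_N.

Definition ord_fun (f : nat -> nat) (x : I) : I := inord (f x).

Lemma ord_funE f (x : I) : (forall y, y < N -> f y < N) -> ord_fun f x = f x :> nat.
Proof. by move=> fN; rewrite /ord_fun inordK ?fN. Qed.

Lemma ord_fun_inj f : (forall y, y < N -> f y < N) -> {in gtn N &, injective f} ->
  injective (ord_fun f).
Proof.
move=> fN fI x y /(congr1 val); rewrite /= !ord_funE // => /fI E.
by apply: val_inj; apply: E; rewrite inE ltn_ord.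
Qed.

Lemma rowF_lt y : y < N -> rowF y < N. Proof. by case/row_bound. Qed.
Lemma rowC_lt y : y < N -> rowC y < N. Proof. by case/row_bound. Qed.
Lemma rowD_lt y : y < N -> rowD y < N. Proof. by case/row_bound. Qed.
Lemma swapF_lt y : y < N -> swapF y < N. Proof. by case/row_bound. Qed.
Lemma swapC_lt y : y < N -> swapC y < N. Proof. by case/row_bound => _ _ _ _ []. Qed.
Lemma swapD_lt y : y < N -> swapD y < N. Proof. by case/row_bound => _ _ _ _ []. Qed.

Definition permF : {perm I} := perm (ord_fun_inj rowF_lt rowF_inj).
Definition permC : {perm I} := perm (ord_fun_inj rowC_lt rowC_inj).
Definition permD : {perm I} := perm (ord_fun_inj rowD_lt rowD_inj).

Lemma permFE x : permF x = rowF x :> nat.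
Proof. by rewrite permE ord_funE //; apply: rowF_lt. Qed.
Lemma permCE x : permC x = rowC x :> nat.
Proof. by rewrite permE ord_funE //; apply: rowC_lt. Qed.
Lemma permDE x : permD x = rowD x :> nat.
Proof. by rewrite permE ord_funE //; apply: rowD_lt. Qed.

Lemma perm_distinct x :
  [&& permF x != permC x, permF x != permD x & permC x != permD x].
Proof. by rewrite -!val_eqE /= !permFE !permCE !permDE row_distinct. Qed.

(** The arcs left for the rows found by Hall's theorem; they form a regular bipartite graph of
    degree [h.+4], the order minus three. *)
Definition free_arc (x y : I) : bool :=
  y \notin [:: permF x; permC x; permD x].

Lemma card_free_out x : #|[set y | free_arc x y]| = h.+4.
Proof.
have /and3P[FC FD CD] := perm_distinct x.
have -> : [set y | free_arc x y] = ~: [set y in [:: permF x; permC x; permD x]].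
  by apply/setP => y; rewrite !inE /free_arc !inE.
rewrite cardsCs setCK card_ord cardsE (card_uniqP _) /= ?inE ?negb_or ?FC ?FD ?CD //.
Qed.

Lemma card_free_in y : #|[set x | free_arc x y]| = h.+4.
Proof.
pose s := [:: permF^-1 y; permC^-1 y; permD^-1 y]%g.
have -> : [set x | free_arc x y] = ~: [set x in s].
  apply/setP => x; rewrite !inE /free_arc !inE.
  by rewrite ![y == _]eq_sym !(can2_eq (permK _) (permKV _)).
have neq (p q : {perm I}) : (forall x, p x != q x) -> (p^-1 y != q^-1 y)%g.
  move=> pq; apply: contraNneq (pq (p^-1 y)%g) => E.
  by rewrite permKV E permKV.
have us : uniq s.
  rewrite /= !inE negb_or !neq // => x; by case/and3P: (perm_distinct x).
by rewrite cardsCs setCK card_ord cardsE (card_uniqP us).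
Qed.

(** Row F has to sit at [ord_max], the index of the colour with an in-layer arc; the rows from
    Hall's theorem fill the indices from 2 on. *)
Definition select (A : Type) (a b c : A) (q : nat -> A) (j : I) : A :=
  if j == ord_max then a else
  match val j with 0 => b | 1 => c | i.+2 => q i end.

Lemma select_inj (A : eqType) (a b c : A) (q : nat -> A) :
  [&& a != b, a != c & b != c] ->
  (forall i, i < h.+4 -> q i \notin [:: a; b; c]) ->
  (forall i j, i < h.+4 -> j < h.+4 -> q i = q j -> i = j) ->
  injective (select a b c q).
Proof.
move=> /and3P[ab ac bc] qabc qI.
have q_lt (j : I) i : val j = i.+2 -> j != ord_max -> i < h.+4.
  by rewrite -val_eqE /=; have := ltn_ord j; lia.
move=> j l; rewrite /select.
have [->|jm] := eqVneq j ord_max; have [->|lm] := eqVneq l ord_max => //.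
- case El: (val l) => [|[|i]] E; rewrite ?E ?eqxx in ab ac => //.
  by have := qabc i (q_lt _ _ El lm); rewrite -E inE eqxx.
- case Ej: (val j) => [|[|i]] E; rewrite -?E ?eqxx in ab ac => //.
  by have := qabc i (q_lt _ _ Ej jm); rewrite E inE eqxx.
- move=> E; apply: val_inj; move: E.
  case Ej: (val j) => [|[|i]]; case El: (val l) => [|[|i']] //= E.
  + by rewrite E eqxx in bc.
  + by have := qabc i' (q_lt _ _ El lm); rewrite -E !inE eqxx orbT.
  + by rewrite E eqxx in bc.
  + by have := qabc i' (q_lt _ _ El lm); rewrite -E !inE eqxx !orbT.
  + by have := qabc i (q_lt _ _ Ej jm); rewrite E !inE eqxx orbT.
  + by have := qabc i (q_lt _ _ Ej jm); rewrite E !inE eqxx !orbT.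
  + by rewrite (qI _ _ (q_lt _ _ Ej jm) (q_lt _ _ El lm) E).
Qed.

Lemma selectE (A B : Type) (F : A -> B) a b c q j :
  F (select a b c q j) = select (F a) (F b) (F c) (F \o q) j.
Proof. by rewrite /select; case: ifP => // _; case: (val j) => [|[|i]]. Qed.

Definition transpose (a b y : nat) : nat :=
  if y == a then b else if y == b then a else y.

(** The cycle [y -> swapC y + 1] passes [h + 2, h + 5, h + 4, h + 3, h + 6]: numerical order with
    [h + 3] and [h + 5] exchanged. *)
Lemma lapC y : y < N -> y != h + 6 -> (swapC y != h + 6) &&
  (transpose (h + 3) (h + 5) y < transpose (h + 3) (h + 5) (swapC y).+1 <= h + 6).
Proof. by rewrite /transpose => /columnP[] Hy ?; do !case: eqP; lia. Qed.

(** Here the cycle ends with [h + 3, h + 6, h + 5, h + 4]. *)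
Lemma lapD y : y < N -> y != h + 4 -> (swapD y != h + 6) &&
  (transpose (h + 4) (h + 6) y < transpose (h + 4) (h + 6) (swapD y).+1 <= h + 6).
Proof. by rewrite /transpose => /columnP[] Hy ?; do !case: eqP; lia. Qed.

Lemma layer_kit_large : inhabited (layer_kit N (option I)).
Proof.
have [p [pe pI]] := regular_bipartite_decomposition card_free_out card_free_in.
pose R0 := select permF permC permD p.
pose sw := select (ord_fun swapF) (ord_fun swapC) (ord_fun swapD) (fun=> id).
(* With these choices the lap of row [j] is [ordS \o sw j], which is [ordS] itself on the rows from
   Hall's theorem. *)
pose s1 j x := R0 j (sw j x).
pose s2 j y := ordS ((R0 j)^-1 y)%g.
have swF x : ord_fun swapF x = swapF x :> nat by rewrite ord_funE //; apply: swapF_lt.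
have swC x : ord_fun swapC x = swapC x :> nat by rewrite ord_funE //; apply: swapC_lt.
have swD x : ord_fun swapD x = swapD x :> nat by rewrite ord_funE //; apply: swapD_lt.
have sw_inj j : injective (sw j).
  have swFI : injective (ord_fun swapF).
    apply: ord_fun_inj; first exact: swapF_lt.
    by move=> y z /columnP[] Hy /columnP[] Hz; lia.
  have swCI : injective (ord_fun swapC).
    apply: ord_fun_inj; first exact: swapC_lt.
    by move=> y z /columnP[] Hy /columnP[] Hz; lia.
  have swDI : injective (ord_fun swapD).
    apply: ord_fun_inj; first exact: swapD_lt.
    by move=> y z /columnP[] Hy /columnP[] Hz; lia.
  by rewrite /sw /select; case: ifP => // _; case: (val j) => [|[|i]].
have R0_col x : injective (fun j => R0 j x).
  move=> j l; rewrite /R0 !(selectE (fun g : {perm I} => g x)).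
  apply: select_inj; first exact: perm_distinct.
    by move=> i ih; apply: pe.
  by move=> i i' ih ih'; apply: pI.
have L1 : latin s1.
  split=> [j x y /perm_inj/sw_inj //|x].
  pose q i := p i x.
  have s1E j : s1 j x = select (permF (ord_fun swapF x)) (permC (ord_fun swapC x))
      (permD (ord_fun swapD x)) q j.
    by rewrite /s1 /R0 /sw /select; case: ifP => // _; case: (val j) => [|[|i]].
  have [FC FD CD [inF inC inD]] := swap_distinct (ltn_ord x).
  move=> j l; rewrite /= !s1E; apply: select_inj.
  - by rewrite -!val_eqE /= !permFE !permCE !permDE swF swC swD FC FD CD.
  - move=> i ih; have := pe i x ih; rewrite /free_arc /q !inE -!val_eqE /=.
    rewrite !permFE !permCE !permDE swF swC swD.
    move: inF inC inD; rewrite !inE.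
    rewrite !negb_or => + + + /and3P[nF nC nD].
    by do 3 case/or3P => /eqP ->; rewrite ?nF ?nC ?nD.
  - by move=> i i' ih ih'; apply: pI.
have L2 : latin s2.
  split=> [j x y /(@ordS_inj N)/perm_inj //|y j l /(@ordS_inj N) E].
  by apply: (R0_col ((R0 j)^-1 y)%g) => /=; rewrite permKV E permKV.
have s2s1 j x : s2 j (s1 j x) = ordS (sw j x) by rewrite /s2 /s1 permK.
have R0max : R0 ord_max = permF by rewrite /R0 /select eqxx.
have swmax : sw ord_max = ord_fun swapF by rewrite /sw /select eqxx.
have vin n : n < N -> (inord n : I) = n :> nat by move=> nN; rewrite inordK.
have vmax : @ord_max h.+2.+4 = h + 6 :> nat by rewrite /=; lia.
have ordSE (y : I) : ordS y = (if y == h + 6 :> nat then 0 else y.+1) :> nat.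
  rewrite /=; case: eqP => [->|yh]; first by rewrite (_ : (h + 6).+1 = N) ?modnn; lia.
  by rewrite modn_small //; have := ltn_ord y; lia.
have Fmax : permF ord_max = ord_max.
  by apply: val_inj; rewrite /= permFE; case: (columnP (ltn_ord ord_max)) => /=; lia.
have Fsw : swapF (h + 6) = h + 2 by case: (@columnP (h + 6)) => //; lia.
have F0 : rowF (h + 2) = 0 by case: (@columnP (h + 2)) => //; lia.
have s1max : s1 ord_max ord_max = ord0.
  by apply: val_inj; rewrite /= /s1 R0max swmax permFE swF vmax Fsw F0.
have s2max : s2 ord_max ord_max = ord0.
  by apply/eqP; rewrite /s2 R0max -{1}Fmax permK ordS_eq0.
have s2_0 : s2 ord_max ord0 = h + 3 :> nat.
  have -> : ord0 = permF (inord (h + 2)) :> I.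
    by apply: val_inj; rewrite /= permFE inordK ?F0 //; lia.
  rewrite /s2 R0max permK ordSE /= inordK; last by lia.
  by case: eqP; lia.
pose x0 (j : I) : I :=
  inord (if j == ord_max then h + 5 else
         match val j with 0 => h + 6 | 1 => h + 4 | _ => 0 end).
constructor; apply: (@latin_kit _ s1 s2 L1 L2 s1max s2max x0) => //.
- move=> j x jm; rewrite (@eq_fconnect _ _ (fun y => ordS (sw j y))); last first.
    by move=> y; apply: s2s1.
  rewrite /x0 /sw /select (negbTE jm); case: (val j) => [|[|i]].
  + pose r (y : I) := transpose (h + 3) (h + 5) y.
    apply: (@fconnect_potential _ _ r (h + 6) predT) => // y _.
    rewrite -val_eqE /= vin; last by lia.
    move/(lapC (ltn_ord y)) => /andP[/negbTE ym].
    by rewrite /r ordSE swC ym.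
  + pose r (y : I) := transpose (h + 4) (h + 6) y.
    apply: (@fconnect_potential _ _ r (h + 6) predT) => // y _.
    rewrite -val_eqE /= vin; last by lia.
    move/(lapD (ltn_ord y)) => /andP[/negbTE ym].
    by rewrite /r ordSE swD ym.
  + exact: ordS_spanning.
- move=> x xm; rewrite /x0 eqxx; set g := (_ \o s1 ord_max).
  (* Exchanging [h + 2] and [h + 6] splits [ordS] into two cycles; settling [ord_max] at [0] joins
     them again to [0, 1, ..., h + 5]. *)
  have gE (y : I) : y < h + 5 -> g y = y.+1 :> nat.
    move=> y5; have yN := ltn_ord y.
    have stE u : latin_st (Some ord_max) u = if u == ord_max then ord0 else u :> I.
      by rewrite /latin_st eqxx.
    rewrite /g /comp !stE.
    have [yk|yk] := eqVneq (y : nat) (h + 2).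
      have -> : s1 ord_max y = ord_max.
        rewrite /s1 R0max swmax (_ : ord_fun swapF y = ord_max) //.
        apply: val_inj; rewrite /= swF yk; case: (@columnP (h + 2)) => //; lia.
      have /negbTE nm : s2 ord_max ord0 != ord_max.
        by apply/eqP => /(congr1 (@nat_of_ord N)); rewrite s2_0 vmax; lia.
      by rewrite eqxx nm s2_0; lia.
    have /negbTE -> : s1 ord_max y != ord_max.
      rewrite /s1 R0max swmax -{1}Fmax (inj_eq perm_inj) -val_eqE /= swF.
      by case: (columnP yN); lia.
    have E : ordS (ord_fun swapF y) = y.+1 :> nat.
      by rewrite ordSE swF; case: (columnP yN) => Hy; case: eqP; lia.
    have /negbTE nm : ordS (ord_fun swapF y) != ord_max.
      by apply/eqP => /(congr1 (@nat_of_ord N)); rewrite E vmax; lia.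
    by rewrite s2s1 swmax nm E.
  apply: (@fconnect_potential _ _ (@nat_of_ord N) (h + 5) (predC1 ord_max)) => // y.
  rewrite /= -!val_eqE /= vin => [ym y5|]; last by lia.
  by have yN := ltn_ord y; rewrite gE; lia.
Qed.
End Rows.

(** * Layers of a factorization *)

Lemma cycle_factorization_reindex (T : finType) (e : rel T) (K L : finType)
    (f : K -> T -> T) (g : L -> K) :
  bijective g -> cycle_factorization e f -> cycle_factorization e (f \o g).
Proof.
case=> g' gK g'K [sf fI fe]; split=> [l|x l l' /fI /(can_inj gK)|x y] //.
  exact: sf.
rewrite fe; apply/existsP/existsP => -[k fk]; last by exists (g k).
by exists (g' k); rewrite /= g'K.
Qed.

(** A vertex has [m] arcs to the next layer and one in its own, which fixes the number of colours;
    when [G] is a directed cycle, one hamiltonian cycle has all its arcs. *)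
Lemma wreath_functional_factorization (T : finType) (G : rel T) (n m : nat) :
  irreflexive G -> hamiltonian_decomposable G -> digraph_iso G (@dicycle n) ->
  hamiltonian_decomposable (wreath G (@dicycle m)) ->
  exists phi : T -> T, [/\ spanning phi, forall t, phi t != t, 1 < #|T|
    & exists h : 'I_m.+1 -> T * 'I_m -> T * 'I_m,
        cycle_factorization (wreath (frel phi) (@dicycle m)) h].
Proof.
move=> irrG /decomposable_factorization[T1 [L [l0 [f [sf _ fG]]]]].
case=> iso [[iso' isoK _] isoG] /decomposable_factorization[Tm1 [K [_ [h hP]]]].
have Gf t : G t (f l0 t) by rewrite fG; apply/existsP; exists l0.
exists (f l0).
have GE t t' : G t t' = (f l0 t == t').
  apply/idP/eqP => [|<-//]; rewrite -isoG => /eqP E; apply: (can_inj isoK).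
  by have := Gf t; rewrite -isoG => /eqP ->.
have irr t : f l0 t != t by rewrite -GE irrG.
split=> //.
have {}hP : cycle_factorization (wreath (frel (f l0)) (@dicycle m)) h.
  by case: hP => sh hI he; split=> // x y; rewrite -he /wreath GE.
have t0 : T by case: (pickP T) T1 => // /eq_card0 ->.
have m0 : 0 < m by move: Tm1; rewrite card_prod card_ord; lia.
pose x0 := Ordinal m0.
have cK : #|K| = m.+1.
  case: hP => sh hI he; pose p := (t0, x0).
  rewrite -(card_imset _ (hI p)).
  pose A := [set (f l0 t0, y) | y in [set: 'I_m]].
  have -> : [set h k p | k in K] = (t0, ordS x0) |: A.
    apply/setP => q; apply/imsetP/setU1P.
      case=> k _ E; have : wreath (frel (f l0)) (@dicycle m) p q.
        by rewrite he; apply/existsP; exists k; rewrite E.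
      case: q {E} => t y; rewrite /wreath /dicycle /=.
      case/orP=> [/eqP <-|/andP[/eqP <- /eqP ->]]; last by left.
      by right; apply: imset_f.
    move=> qA; have : wreath (frel (f l0)) (@dicycle m) p q.
      rewrite /wreath /dicycle; case: qA => [->|/imsetP[y _ ->]] /=.
        by rewrite !eqxx orbT.
      by rewrite eqxx.
    by rewrite he => /existsP[k /eqP <-]; exists k.
  rewrite cardsU1 card_imset; last by move=> y y' [].
  rewrite cardsT card_ord; case: imsetP => // -[y _ [E _]].
  by have := irr t0; rewrite -E eqxx.
exists (h \o (fun i => enum_val (cast_ord (esym cK) i))).
apply: cycle_factorization_reindex hP.
exists (fun k => cast_ord cK (enum_rank k)) => [i|k] /=.
  by rewrite enum_valK cast_ordKV.
by rewrite cast_ordK enum_rankK.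
Qed.

Section FunctionalWreath.
Variables (m : nat) (T : finType) (phi : T -> T).
Local Notation I := 'I_m.+1.
Variable h : 'I_m.+2 -> T * I -> T * I.
Hypotheses (sphi : spanning phi) (phi_irr : forall t, phi t != t).
Hypothesis hP : cycle_factorization (wreath (frel phi) (@dicycle m.+1)) h.
Implicit Types (t : T) (x y : I) (k l : 'I_m.+2).

Lemma factor_inj k : injective (h k).
Proof. by case: hP => sh _ _; apply: spanning_inj. Qed.

Lemma factor_colour_inj p : injective (h^~ p).
Proof. by case: hP. Qed.

Lemma factor_arc t x t' y :
  (t' == phi t) || ((t' == t) && (y == ordS x)) -> exists k, h k (t, x) = (t', y).
Proof.
case: hP => _ _ /(_ (t, x) (t', y)); rewrite /wreath /dicycle /= => E.
rewrite [t' == _]eq_sym [t' == t]eq_sym E => /existsP[k /eqP hk].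
by exists k.
Qed.

Definition vcol t x : 'I_m.+2 :=
  odflt ord0 [pick k | h k (t, x) == (t, ordS x)].

Lemma factor_vcol t x : h (vcol t x) (t, x) = (t, ordS x).
Proof.
have [|k hk] := @factor_arc t x t (ordS x); first by rewrite !eqxx orbT.
by rewrite /vcol; case: pickP => [l /eqP //|/(_ k)]; rewrite hk eqxx.
Qed.

Lemma factor_forward k t x : vcol t x != k -> (h k (t, x)).1 = phi t.
Proof.
move=> kv; case: hP => _ _ /(_ (t, x) (h k (t, x))).
rewrite /wreath /dicycle /= => E.
have {E} /orP[/eqP <- //|/andP[/eqP E1 /eqP E2]] :
    (phi t == (h k (t, x)).1) || (t == (h k (t, x)).1) && ((h k (t, x)).2 == ordS x).
  by rewrite E; apply/existsP; exists k.
case/negP: kv; apply/eqP/(@factor_colour_inj (t, x)); rewrite /= factor_vcol {1}E1 -E2.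
by case: (h k _).
Qed.

Lemma factor_forwardE k t x : vcol t x != k -> h k (t, x) = (phi t, (h k (t, x)).2).
Proof. by move=> /factor_forward <-; case: (h k _). Qed.

(* An arc entering a layer never ends at the head of an in-layer arc of the
   same colour. *)
Lemma factor_not_head k t x y : vcol t x != k -> vcol (phi t) y = k ->
  (h k (t, x)).2 != ordS y.
Proof.
move=> kx ky; apply/eqP => E; have := factor_vcol (phi t) y.
rewrite ky -E -factor_forwardE // => /(@factor_inj k) [Et _].
by have := phi_irr t; rewrite {1}Et eqxx.
Qed.

Definition vcount k t : nat := #|[set x | vcol t x == k]|.

(** Forward arcs of colour [k] avoid the heads of in-layer arcs of colour [k], so the count cannot
    grow from one layer to the next; around the cycle it is constant. *)
Lemma vcount_const k t t' : vcount k t = vcount k t'.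
Proof.
suff le u : vcount k (phi u) <= vcount k u.
  have le_conn u v : fconnect phi u v -> vcount k v <= vcount k u.
    move/iter_findex => <-; elim: (findex _ _ _) => //= i.
    exact/leq_trans/le.
  by apply/eqP; rewrite eqn_leq !le_conn // sphi.
pose V w := [set x | vcol w x == k].
pose B := @ordS m.+1 @: V (phi u).
pose A := [set (h k (u, x)).2 | x in ~: V u].
have cB : #|B| = vcount k (phi u) by rewrite card_imset //; apply: ordS_inj.
have cA : #|A| = #|~: V u|.
  apply: card_in_imset => x y; rewrite !inE => kx ky E.
  suff /(@factor_inj k) [] : h k (u, x) = h k (u, y) by [].
  by rewrite factor_forwardE // E -factor_forwardE.
have /subset_leq_card : A \subset ~: B.
  apply/subsetP => _ /imsetP[x + ->]; rewrite !inE => kx.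
  apply/imsetP => -[y]; rewrite inE => /eqP ky /eqP.
  by apply/negP; apply: factor_not_head.
have := cardsC (V u); have := cardsC B; rewrite card_ord cB cA.
rewrite -/(vcount k u); lia.
Qed.

(** A colour with all in-layer arcs of a layer would never leave it. *)
Lemma vcount_lt k t : vcount k t < m.+1.
Proof.
have le_m : vcount k t <= m.+1 by rewrite -[X in _ <= X]card_ord max_card.
rewrite ltn_neqAle le_m andbT; apply/eqP => full.
have all_v x : vcol t x = k.
  have /eqP E : [set x | vcol t x == k] == setT.
    by rewrite eqEcard subsetT cardsT card_ord -/(vcount k t) full /=.
  by have := in_setT x; rewrite -E inE => /eqP.
case: hP => sh _ _; have := sh k (t, ord0) (phi t, ord0).
move/iter_findex; move: (findex _ _ _) => i.
suff -> : (iter i (h k) (t, ord0)) = (t, iter i (@ordS m.+1) ord0).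
  by case=> E; have := phi_irr t; rewrite -E eqxx.
by elim: i => //= i ->; rewrite -(all_v (iter i (@ordS m.+1) ord0)) factor_vcol.
Qed.

Lemma sum_vcount t : \sum_k vcount k t = m.+1.
Proof.
rewrite -[RHS]card_ord -sum1_card (partition_big (vcol t) predT) //=.
by apply: eq_bigr => k _; rewrite /vcount -sum1dep_card.
Qed.

End FunctionalWreath.

(** * Layers of size two *)

Lemma ord2_neq (x y : 'I_2) : x != y -> y = ordS x.
Proof.
rewrite -val_eqE => /= xy; apply: val_inj => /=.
by move: x y xy => [[|[|//]] ?] [[|[|//]] ?].
Qed.

Lemma no_factorization2 (T : finType) (phi : T -> T)
    (h : 'I_3 -> T * 'I_2 -> T * 'I_2) :
  spanning phi -> (forall t, phi t != t) -> 0 < #|T| ->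
  ~ cycle_factorization (wreath (frel phi) (@dicycle 2)) h.
Proof.
move=> sphi irr /card_gt0P[t0 _] hP.
have le1 k t : vcount h k t < 2 by apply: (vcount_lt irr hP).
have const k t t' := vcount_const sphi irr hP k t t'.
pose b := vcol h t0 ord0; pose b' := vcol h t0 (ordS ord0).
have v1 k t x y : vcol h t x = k -> vcol h t y = k -> x = y.
  move=> tx ty; have /card_le1_eqP := le1 k t; apply; rewrite inE ?tx ?ty //.
have vcnt k t x : vcol h t x = k -> forall t', exists y, vcol h t' y = k.
  move=> tx t'; have /card_gt0P[y] : 0 < vcount h k t'.
    by rewrite (const k t' t); apply/card_gt0P; exists x; rewrite inE tx.
  by rewrite inE => /eqP; exists y.
have bb' : b != b' by apply/eqP => E; have := v1 _ _ _ _ (erefl b) (esym E).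
(* The two in-layer arcs of a layer have distinct colours [b] and [b'], so the third colour [c] has
   none. *)
have [c cb cb'] : exists2 c, c != b & c != b'.
  have : 0 < #|~: [set b; b']|.
    by have := cardsC [set b; b']; rewrite cards2 bb' card_ord; lia.
  by case/card_gt0P => c; rewrite !inE negb_or => /andP[]; exists c.
have vb t x : vcol h t x = b \/ vcol h t x = b'.
  have [y yb] := vcnt b t0 ord0 erefl t.
  have [y' yb'] := vcnt b' t0 (ordS ord0) erefl t.
  have yy' : y != y' by apply: contraNneq bb' => E; rewrite -yb -yb' E.
  have [<-|xy] := eqVneq y x; [by left|right].
  by rewrite (ord2_neq xy) -(ord2_neq yy').
(* From a tail of [b], colour [b'] cannot enter the head of its next in-layer arc and so enters the
   tail; [c] is left with the other vertex, again a tail of [b]. *)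
have step p : vcol h p.1 p.2 = b -> vcol h (h c p).1 (h c p).2 = b.
  case: p => t x /= tx; have nc : vcol h t x != c by rewrite tx eq_sym.
  have nb' : vcol h t x != b' by rewrite tx.
  rewrite (factor_forward hP nc); case: (vb (phi t) (h c (t, x)).2) => // yb'.
  have := factor_not_head irr hP nb' yb'; 
  rewrite -(@ord2_neq _ (h b' (t, x)).2) ?eqxx //.
  apply: contraNneq cb' => E; apply/eqP.
  apply: (@factor_colour_inj _ _ _ _ hP (t, x)) => /=.
  by rewrite (factor_forwardE hP nc) E -(factor_forwardE hP nb').
case: (hP) => sh _ _; have := sh c (t0, ord0) (t0, ordS ord0).
move/iter_findex; move: (findex _ _ _) => i E.
have inv j : vcol h (iter j (h c) (t0, ord0)).1 (iter j (h c) (t0, ord0)).2 = b.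
  by elim: j => [|j IH] //; rewrite iterS; apply: step.
by have := inv i; rewrite E /= => /eqP; rewrite eq_sym (negbTE bb').
Qed.

(** * Signs of permutations acting on layers *)

(** A factorization of [p] into transpositions is carried along [i] to one of [q] with equally many
    factors. *)
Lemma odd_perm_embed (T V : finType) (i : T -> V) (p : {perm T}) (q : {perm V}) :
  injective i -> (forall t, q (i t) = i (p t)) ->
  (forall v, v \notin codom i -> q v = v) -> odd_perm q = odd_perm p.
Proof.
move=> iI qi qfix; have [ts pE tsP] := prod_tpermP p.
pose us := [seq (i t.1, i t.2) | t <- ts].
have qE : q = (\prod_(u <- us) tperm u.1 u.2)%g.
  apply/perm.permP => v; have [/codomP[t ->]|vi] := boolP (v \in codom i).
    rewrite qi pE {pE tsP}/us; elim: ts t => [|u ts IH] t.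
      by rewrite !big_nil !perm1.
    rewrite map_cons !big_cons !permM IH; congr (_ _).
    by rewrite /= inj_tperm.
  rewrite qfix // {pE tsP}/us; elim: ts => [|u ts IH].
    by rewrite !big_nil !perm1.
  rewrite map_cons !big_cons !permM /= tpermD //.
    by apply: contraNneq vi => <-; apply: codom_f.
  by apply: contraNneq vi => <-; apply: codom_f.
rewrite qE pE !odd_perm_prod ?size_map //.
by apply/allP => _ /mapP[t /(allP tsP) + ->]; rewrite /dpair /= (inj_eq iI).
Qed.

Lemma odd_perm_spanning (T : finType) (p : {perm T}) :
  spanning p -> 0 < #|T| -> odd_perm p = ~~ odd #|T|.
Proof.
move=> sp /card_gt0P[x0 _].
rewrite /odd_perm (_ : porbits p = [set setT]) ?cards1 ?addbT //.
have pT x : porbit p x = setT.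
  apply/setP => y; rewrite inE; apply/porbitP; exists (findex p x y).
  by rewrite permX iter_findex.
apply/setP => A; rewrite inE; apply/imsetP/eqP => [[x _ ->] //|->].
by exists x0.
Qed.

Section Fibers.
Variables T U : finType.

Definition fiber_fun (s : T -> {perm U}) (p : T * U) := (p.1, s p.1 p.2).

Lemma fiber_fun_inj s : injective (fiber_fun s).
Proof. by move=> [t x] [t' x'] [-> /perm_inj ->]. Qed.

Definition fiber_perm s : {perm T * U} := perm (@fiber_fun_inj s).

(** [fiber_perm s] is a product of permutations that each move a single fiber, where
    [odd_perm_embed] gives the sign. *)
Lemma odd_fiber_perm s :
  odd_perm (fiber_perm s) = \big[addb/false]_t odd_perm (s t).
Proof.
pose sr (r : seq T) t := if t \in r then s t else 1%g.
have gen r : uniq r ->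
    odd_perm (fiber_perm (sr r)) = \big[addb/false]_(t <- r) odd_perm (s t).
  elim: r => [|t r IH] /= => [_|/andP[tr ur]].
    rewrite big_nil -(@odd_perm1 (T * U)%type); congr odd_perm.
    by apply/perm.permP => -[t x]; rewrite permE perm1 /fiber_fun /sr /= perm1.
  rewrite big_cons -IH //.
  pose d u := if u == t then s t else 1%g.
  have -> : fiber_perm (sr (t :: r)) = (fiber_perm d * fiber_perm (sr r))%g.
    apply/perm.permP => -[u x]; rewrite permM !permE /fiber_fun /sr /d /= inE.
    have [->|ut] := eqVneq u t; first by rewrite (negbTE tr) perm1.
    by rewrite perm1.
  rewrite odd_permM; congr (_ (+) _).
  apply: (odd_perm_embed (i := fun x => (t, x))).
  - by move=> x y [].
  - by move=> x; rewrite permE /fiber_fun /d /= eqxx.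
  - move=> [u x] ux; rewrite permE /fiber_fun /d /=.
    by case: eqP ux => [->|_ _]; [rewrite codom_f|rewrite perm1].
rewrite -gen ?index_enum_uniq //; congr odd_perm.
by apply/perm.permP => -[t x]; rewrite !permE /fiber_fun /sr /= mem_index_enum.
Qed.

End Fibers.

(** * Layers of size three *)

(* Row [x] of [rs] lists the colour of the in-layer arc at [x], followed by the
   colours of the three arcs from [x] to the next layer. *)
Section Rows3.
Variable rs : seq (seq nat).

(** No arc from this layer enters [y] in colour [k], so [y] is the head of an in-layer arc of colour
    [k] in the next one. The default [4] is not a colour. *)
Definition col_missing (k y : nat) : bool := all (fun r => nth 4 r y.+1 != k) rs.
Definition head3 (k : nat) : nat := find (col_missing k) (iota 0 3).
Definition sigma3 (k x : nat) : nat :=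
  if index k (nth [::] rs x) is i.+1 then i else head3 k.
Definition inversions3 (a b c : nat) : bool := (b < a) (+) (c < a) (+) (c < b).
Definition parity3 (k : nat) : bool :=
  inversions3 (sigma3 k 0) (sigma3 k 1) (sigma3 k 2).
Definition count3 (k : nat) : nat := count (fun r => nth 4 r 0 == k) rs.

(** Necessary conditions: each colour is injective between the layers and keeps its number of
    in-layer arcs. *)
Definition admissible3 : bool :=
  all (fun y => uniq (map (nth 4 ^~ y.+1) rs)) (iota 0 3) &&
  all (fun k => count3 k == count (col_missing k) (iota 0 3)) (iota 0 4).

(** The first law serves the counts [1, 1, 1, 0], the second [2, 1, 0, 0]; four counts below [3]
    with sum [3] leave no other case. *)
Definition parity_law3 : bool :=
  (all (fun k => count3 k <= 1) (iota 0 4) ==>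
     parity3 0 (+) parity3 1 (+) parity3 2 (+) parity3 3) &&
  (has (fun k => count3 k == 2) (iota 0 4) ==>
     all (fun k => all (fun l => (count3 k == 1) && (count3 l == 0) ==>
       (parity3 k == parity3 l)) (iota 0 4)) (iota 0 4)).

End Rows3.

Lemma parity_law3P r0 r1 r2 :
  all (perm_eq (iota 0 4)) [:: r0; r1; r2] -> admissible3 [:: r0; r1; r2] ->
  parity_law3 [:: r0; r1; r2].
Proof.
pose ps := permutations (iota 0 4).
have check : all (fun r0 => all (fun r1 => all (fun r2 =>
    admissible3 [:: r0; r1; r2] ==> parity_law3 [:: r0; r1; r2]) ps) ps) ps.
  by vm_compute.
have mem r : perm_eq (iota 0 4) r -> r \in ps.
  by move=> pr; rewrite mem_permutations perm_sym.
rewrite /= => /and4P[/mem p0 /mem p1 /mem p2 _].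
by apply/implyP; have /allP/(_ _ p0)/allP/(_ _ p1)/allP/(_ _ p2) := check.
Qed.

Lemma odd_perm_ord3 (s : {perm 'I_3}) (a b c : 'I_3) :
  val a = 0 -> val b = 1 -> val c = 2 ->
  odd_perm s = inversions3 (s a) (s b) (s c).
Proof.
move=> a0 b1 c2.
have ab : a != b by rewrite -val_eqE a0 b1.
have ac : a != c by rewrite -val_eqE a0 c2.
have bc : b != c by rewrite -val_eqE b1 c2.
have ba : b != a by rewrite eq_sym.
have ca : c != a by rewrite eq_sym.
have cb : c != b by rewrite eq_sym.
have ordE x : [|| x == a, x == b | x == c].
  by rewrite -!val_eqE a0 b1 c2; case: x => [[|[|[|]]]].
have gen (p : {perm 'I_3}) : s a = p a -> s b = p b -> s c = p c -> s = p.
  by move=> ? ? ?; apply/perm.permP => x; case/or3P: (ordE x) => /eqP ->.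
have sab : s a != s b by rewrite (inj_eq perm_inj).
have sac : s a != s c by rewrite (inj_eq perm_inj).
have sbc : s b != s c by rewrite (inj_eq perm_inj).
move: sab sac sbc.
case/or3P: (ordE (s a)) => /eqP sa; case/or3P: (ordE (s b)) => /eqP sb;
  case/or3P: (ordE (s c)) => /eqP sc; rewrite sa sb sc ?eqxx // => _ _ _;
  rewrite /inversions3 -!/(val _) a0 b1 c2 /=.
- by rewrite (gen 1%g) ?perm1 // odd_perm1.
- have -> : s = tperm b c by apply: gen; rewrite ?tpermL ?tpermR ?tpermD.
  by rewrite odd_tperm bc.
- have -> : s = tperm a b by apply: gen; rewrite ?tpermL ?tpermR ?tpermD.
  by rewrite odd_tperm ab.
- have -> : s = (tperm a b * tperm a c)%g.
    by apply: gen;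
      rewrite permM ?tpermL ?tpermR ?(tpermD ac bc) ?(tpermD ab cb) ?tpermL ?tpermR.
  by rewrite odd_permM !odd_tperm ab ac.
- have -> : s = (tperm a c * tperm a b)%g.
    by apply: gen;
      rewrite permM ?tpermL ?tpermR ?(tpermD ac bc) ?(tpermD ab cb) ?tpermL ?tpermR.
  by rewrite odd_permM !odd_tperm ab ac.
- have -> : s = tperm a c by apply: gen; rewrite ?tpermL ?tpermR ?tpermD.
  by rewrite odd_tperm ac.
Qed.

(** * The parity contradiction for layers of size three *)

Section NoFactorization3.
Variables (T : finType) (phi : T -> T) (h : 'I_4 -> T * 'I_3 -> T * 'I_3).
Hypotheses (sphi : spanning phi) (phi_irr : forall t, phi t != t).
Hypothesis hP : cycle_factorization (wreath (frel phi) (@dicycle 3)) h.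
Hypotheses (T_gt0 : 0 < #|T|) (T_even : ~~ odd #|T|).
Local Notation V := (vcol h).
Local Notation cnt := (vcount h).

Definition vhead (k : 'I_4) (t : T) : 'I_3 :=
  odflt ord0 [pick y | V t (ord_pred y) == k].

(* In-layer arcs of colour [k] are replaced by arcs from their tails to the
   head of the [k]-coloured arc of the next layer. *)
Definition sigma (k : 'I_4) (t : T) (x : 'I_3) : 'I_3 :=
  if V t x == k then vhead k (phi t) else (h k (t, x)).2.

Lemma vcol_unique k t x y : cnt k t <= 1 -> V t x = k -> V t y = k -> x = y.
Proof.
move=> c1 Vx Vy; have /card_le1_eqP := c1.
by apply; rewrite inE ?Vx ?Vy.
Qed.

Lemma vheadE k t x : cnt k t <= 1 -> V t x = k -> vhead k t = ordS x.
Proof.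
move=> c1 Vx; rewrite /vhead; case: pickP => [y /eqP Vy|/(_ (ordS x))].
  by rewrite -(ord_predK y); congr ordS; apply: vcol_unique Vy Vx.
by rewrite ordSK Vx eqxx.
Qed.

Lemma vcol_next k t x : V t x = k -> exists y, V (phi t) y = k.
Proof.
move=> Vx; have /card_gt0P[y] : 0 < cnt k (phi t).
  rewrite (vcount_const sphi phi_irr hP k _ t).
  by apply/card_gt0P; exists x; rewrite inE Vx.
by rewrite inE => /eqP; exists y.
Qed.

(** The added arc ends at the one vertex that no forward arc of colour [k] enters. *)
Lemma sigma_inj k t : cnt k t <= 1 -> injective (sigma k t).
Proof.
move=> c1; have c1' : cnt k (phi t) <= 1.
  by rewrite (vcount_const sphi phi_irr hP k _ t).
have out x y : V t x = k -> V t y != k -> vhead k (phi t) <> (h k (t, y)).2.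
  move=> Vx Vy; have [z Vz] := vcol_next Vx; rewrite (vheadE c1' Vz) => E.
  by have := factor_not_head phi_irr hP Vy Vz; rewrite -E eqxx.
move=> x y; rewrite /sigma; case: ifPn => [/eqP Vx|Vx]; case: ifPn => [/eqP Vy|Vy].
- by move=> _; apply: vcol_unique Vx Vy.
- by move/(out _ _ Vx Vy).
- by move/esym/(out _ _ Vy Vx).
- move=> E; suff /(factor_inj hP) [] : h k (t, x) = h k (t, y) by [].
  by rewrite (factor_forwardE hP Vx) E -(factor_forwardE hP Vy).
Qed.

Lemma sigma_perm k t0 : cnt k t0 <= 1 ->
  exists s : T -> {perm 'I_3}, forall t x, s t x = sigma k t x.
Proof.
move=> c1; have c1t t : cnt k t <= 1 by rewrite (vcount_const sphi phi_irr hP k _ t0).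
by exists (fun t => perm (sigma_inj (c1t t))) => t x; rewrite permE.
Qed.

Lemma shift_inj : injective (fun p : T * 'I_3 => (phi p.1, p.2)).
Proof. by move=> [t x] [t' x'] [/(spanning_inj sphi) -> ->]. Qed.

Definition shift_perm : {perm T * 'I_3} := perm shift_inj.

(** [sigma] followed by the shift is [h k] if [k] has no in-layer arc; otherwise it is [h k]
    followed by a cycle on one vertex per layer. Both cycles have even length, hence odd sign. *)
Lemma colour_parity k t0 (s : T -> {perm 'I_3}) :
  cnt k t0 <= 1 -> (forall t x, s t x = sigma k t x) ->
  (\big[addb/false]_t odd_perm (s t)) (+) odd_perm shift_perm = (cnt k t0 != 1).
Proof.
move=> c1 sE; have c1t t : cnt k t <= 1.
  by rewrite (vcount_const sphi phi_irr hP k _ t0).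
rewrite -odd_fiber_perm -odd_permM.
pose H := perm (factor_inj hP (k := k)).
have oddH : odd_perm H.
  have sH : spanning H.
    case: hP => sh _ _ p q; rewrite (@eq_fconnect _ _ (h k)); first exact: sh.
    by move=> u; rewrite permE.
  by rewrite odd_perm_spanning // card_prod card_ord ?oddM ?andbT // muln_gt0 T_gt0.
have stepE t x : (fiber_perm s * shift_perm)%g (t, x) = (phi t, sigma k t x).
  by rewrite permM !permE /fiber_fun /= sE.
have [c0|] := posnP (cnt k t0).
  have nV t x : V t x != k.
    apply/negP => Vx; have : cnt k t = 0.
      by rewrite (vcount_const sphi phi_irr hP k _ t0).
    by move/eqP; rewrite cards_eq0 => /eqP/setP/(_ x); rewrite !inE Vx.
  rewrite c0 /= -oddH; congr odd_perm; apply/perm.permP => -[t x].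
  by rewrite stepE permE /sigma (negbTE (nV t x)) -(factor_forwardE hP (nV t x)).
move=> c0; have {c0 c1} c1 : cnt k t0 = 1 by lia.
have tailP t : exists x, V t x = k.
  have /card_gt0P[x] : 0 < cnt k t by rewrite (vcount_const sphi phi_irr hP k _ t0) c1.
  by rewrite inE => /eqP; exists x.
(* [cf] carries the head in each layer to the head in the next, which prolongs the in-layer arc of
   colour [k] to the arc of [sigma]. *)
pose cf (p : T * 'I_3) :=
  if p.2 == vhead k p.1 then (phi p.1, vhead k (phi p.1)) else p.
have cfI : injective cf.
  move=> [t x] [t' x']; rewrite /cf /=.
  case: eqP => [->|nx]; case: eqP => [->|nx'].
  - by case=> /(spanning_inj sphi) ->.
  - by case=> E1 E2; case: nx'; rewrite -E1 -E2.
  - by case=> E1 E2; case: nx; rewrite E1 E2.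
  - by [].
pose c := perm cfI.
have oddc : odd_perm c.
  pose f := perm (spanning_inj sphi).
  have -> : odd_perm c = odd_perm f.
    apply: (odd_perm_embed (i := fun t => (t, vhead k t))).
    - by move=> t t' [].
    - by move=> t; rewrite !permE /cf /= eqxx.
    - move=> [t x] tx; rewrite permE /cf /=; case: eqP tx => // ->.
      by rewrite (codom_f (fun t => (t, vhead k t))).
  rewrite odd_perm_spanning // => t t'; rewrite (@eq_fconnect _ _ phi) //.
  by move=> u; rewrite permE.
rewrite c1 eqxx; have -> : (fiber_perm s * shift_perm = H * c)%g.
  apply/perm.permP => -[t x]; rewrite stepE permM !permE /sigma.
  case: ifPn => [/eqP Vx|Vx].
    have := factor_vcol hP t x; rewrite Vx => ->.
    by rewrite /cf /= (vheadE (c1t t) Vx) eqxx.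
  rewrite (factor_forwardE hP Vx) /cf /=; case: eqP => // E.
  have [z Vz] := tailP (phi t); have := factor_not_head phi_irr hP Vx Vz.
  by rewrite E (vheadE (c1t _) Vz) eqxx.
by rewrite odd_permM oddH oddc.
Qed.

Definition fcol (t : T) (x y : 'I_3) : 'I_4 :=
  odflt ord0 [pick k | h k (t, x) == (phi t, y)].

Lemma factor_fcol t x y : h (fcol t x y) (t, x) = (phi t, y).
Proof.
have [|k hk] := @factor_arc _ _ _ _ hP t x (phi t) y; first by rewrite eqxx.
by rewrite /fcol; case: pickP => [l /eqP //|/(_ k)]; rewrite hk eqxx.
Qed.

Lemma fcol_eq t x y k : (fcol t x y == k) = (h k (t, x) == (phi t, y)).
Proof.
apply/eqP/eqP => [<-|E]; first exact: factor_fcol.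
by apply: (@factor_colour_inj _ _ _ _ hP (t, x)); rewrite /= factor_fcol.
Qed.

Definition row3 (t : T) (x : 'I_3) : seq nat :=
  val (V t x) :: [seq val (fcol t x (inord y)) | y <- iota 0 3].
Definition rows3 (t : T) : seq (seq nat) := [seq row3 t (inord x) | x <- iota 0 3].

Lemma row3_perm t x : perm_eq (iota 0 4) (row3 t x).
Proof.
have ur : uniq (row3 t x).
  have nV y : V t x != fcol t x y.
    rewrite eq_sym fcol_eq (factor_vcol hP); apply/eqP => -[E _].
    by have := phi_irr t; rewrite -E eqxx.
  have nM y z : y < 3 -> z < 3 -> y != z -> fcol t x (inord y) != fcol t x (inord z).
    move=> y3 z3; apply: contraNneq => E; have := factor_fcol t x (inord y).
    rewrite E factor_fcol => /(congr1 (fun p : T * 'I_3 => nat_of_ord p.2)) /=.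
    by rewrite !inordK // => ->.
  by rewrite /= !inE !negb_or !val_eqE !nV !nM.
have sub : {subset row3 t x <= iota 0 4}.
  by move=> k; rewrite mem_iota !inE => /or4P[] /eqP ->; apply: ltn_ord.
have [|_ E] := uniq_min_size ur sub; first by [].
by apply: uniq_perm => // k; rewrite E.
Qed.

Lemma all_ord3 (P : pred 'I_3) :
  all (fun x => P (inord x)) (iota 0 3) = [forall x, P x].
Proof.
apply/allP/forallP => [aP x|aP x _]; last exact: aP.
by have := aP (val x); rewrite mem_iota /= inord_val; apply; apply: ltn_ord.
Qed.

Lemma count_ord3 (P : pred 'I_3) : count (fun x => P (inord x)) (iota 0 3) = #|P|.
Proof.
have E n (i : 'I_3) : val i = n -> inord n = i by move=> <-; rewrite inord_val.
rewrite -sum1_card big_mkcond /= !big_ord_recl big_ord0 /= !unfold_in.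
rewrite (E 0 ord0) // (E 1 (lift ord0 ord0)) // (E 2 (lift ord0 (lift ord0 ord0))) //.
Qed.

Lemma nth_row3 t x (y : 'I_3) : nth 4 (row3 t x) y.+1 = fcol t x y.
Proof.
rewrite -[LHS]/(nth 4 [seq val (fcol t x (inord z)) | z <- iota 0 3] y).
by rewrite (nth_map 0) ?size_iota // nth_iota // add0n inord_val.
Qed.

(** Being bijective, [h k] enters [y] in the next layer exactly once, either by a forward arc or by
    an in-layer arc. *)
Lemma rows3_missing t (k : 'I_4) (y : 'I_3) :
  col_missing (rows3 t) k y = (V (phi t) (ord_pred y) == k).
Proof.
rewrite /col_missing /rows3 all_map.
rewrite (@eq_all _ _ (fun x => fcol t (inord x) y != k)) => [|x]; last first.
  by rewrite /preim inE nth_row3 val_eqE.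
rewrite (all_ord3 (fun x => fcol t x y != k)).
apply/forallP/eqP => [aP|Vk x]; last first.
  rewrite fcol_eq; have [Vx|Vx] := eqVneq (V t x) k.
    have := factor_vcol hP t x; rewrite Vx => ->; apply/eqP => -[E _].
    by have := phi_irr t; rewrite -E eqxx.
  have := factor_not_head phi_irr hP Vx Vk; rewrite ord_predK (factor_forwardE hP Vx).
  by rewrite xpair_eqE eqxx.
have [g hK gK] := injF_bij (@factor_inj _ _ _ _ hP k).
case E : (g (phi t, y)) => [t' x'].
have hE : h k (t', x') = (phi t, y) by rewrite -E gK.
have [Vx|Vx] := eqVneq (V t' x') k.
  have := factor_vcol hP t' x'; rewrite Vx hE => -[Et Ey].
  by rewrite Et (_ : y = ordS x') ?ordSK //; apply: val_inj.
have := factor_forward hP Vx; rewrite hE /= => /(spanning_inj sphi) Et; subst t'.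
by have := aP x'; rewrite fcol_eq hE eqxx.
Qed.

Lemma rows3_count t (k : 'I_4) : count3 (rows3 t) k = cnt k t.
Proof.
rewrite /count3 /rows3 count_map /vcount cardsE.
rewrite -(count_ord3 (fun x => V t x == k)).
by apply: eq_count => x; rewrite /= val_eqE.
Qed.

Lemma rows3_count_missing t (k : 'I_4) :
  count (col_missing (rows3 t) k) (iota 0 3) = cnt k t.
Proof.
rewrite (vcount_const sphi phi_irr hP k t (phi t)).
transitivity #|[set y | V (phi t) (ord_pred y) == k]|.
  rewrite cardsE -(count_ord3 (fun y => V (phi t) (ord_pred y) == k)).
  apply: eq_in_count => y; rewrite mem_iota => y3.
  by rewrite -rows3_missing inordK.
rewrite /vcount -(card_imset [set x | V (phi t) x == k] (@ordS_inj 3)).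
congr #|pred_of_set _|; apply/setP => y.
apply/idP/imsetP => [|[x + ->]]; rewrite !inE ?ordSK // => Vy.
by exists (ord_pred y); rewrite ?inE ?ord_predK.
Qed.

Lemma rows3_admissible t : admissible3 (rows3 t).
Proof.
apply/andP; split; apply/allP => y; rewrite mem_iota add0n => /andP[_ y3]; last first.
  have := rows3_count t (Ordinal y3); have := rows3_count_missing t (Ordinal y3).
  by move=> -> ->.
have -> : [seq nth 4 r y.+1 | r <- rows3 t] =
    [seq val (fcol t (inord x) (Ordinal y3)) | x <- iota 0 3].
  rewrite /rows3 -map_comp; apply: eq_map => x.
  exact: (nth_row3 t (inord x) (Ordinal y3)).
rewrite map_inj_in_uniq ?iota_uniq // => x x'; rewrite !mem_iota => x3 x3'.
move/val_inj => E; have := factor_fcol t (inord x) (Ordinal y3).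
rewrite E -(factor_fcol t (inord x') (Ordinal y3)) => /(factor_inj hP).
by case=> /(congr1 val); rewrite /= !inordK.
Qed.

Lemma rows3_head t (k : 'I_4) z : cnt k t <= 1 -> V (phi t) z = k ->
  head3 (rows3 t) k = ordS z.
Proof.
move=> c1 Vz; have c1' : cnt k (phi t) <= 1.
  by rewrite (vcount_const sphi phi_irr hP k _ t).
have hasP : has (col_missing (rows3 t) k) (iota 0 3).
  apply/hasP; exists (val (ordS z)); first by rewrite mem_iota; apply: ltn_ord.
  by rewrite rows3_missing ordSK Vz.
have h3 : head3 (rows3 t) k < 3 by move: hasP; rewrite has_find size_iota.
have := nth_find 0 hasP; rewrite -/(head3 (rows3 t) k) nth_iota // add0n.
rewrite -[X in col_missing _ _ X]/(nat_of_ord (Ordinal h3)) rows3_missing => /eqP Vh.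
by rewrite -(vcol_unique c1' Vh Vz) ord_predK.
Qed.

Lemma rows3_sigma t (k : 'I_4) (x : 'I_3) :
  cnt k t <= 1 -> sigma3 (rows3 t) k x = sigma k t x.
Proof.
move=> c1; rewrite /sigma3 /rows3 (nth_map 0) ?size_iota // nth_iota // add0n.
rewrite inord_val -/(rows3 t) /sigma.
have := perm_uniq (row3_perm t x); rewrite iota_uniq => /esym.
rewrite /row3; set s := map _ _; rewrite cons_uniq => /andP[_ us].
have -> : index (val k) (val (V t x) :: s) =
    if V t x == k then 0 else (index (val k) s).+1 by rewrite -val_eqE.
case: ifPn => [/eqP Vx|Vx].
  have [z Vz] := vcol_next Vx; rewrite (rows3_head c1 Vz) (vheadE _ Vz) //.
  by rewrite (vcount_const sphi phi_irr hP k _ t).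
set y := (h k (t, x)).2.
have fy : fcol t x y = k by apply/eqP; rewrite fcol_eq (factor_forwardE hP Vx).
rewrite -{1}fy -[val (fcol t x y)](nth_row3 t x y).
by rewrite -[nth 4 _ y.+1]/(nth 4 s y) index_uniq // size_map size_iota.
Qed.

Lemma odd_sigma k t (s : {perm 'I_3}) : cnt k t <= 1 ->
  (forall x, s x = sigma k t x) -> odd_perm s = parity3 (rows3 t) k.
Proof.
move=> c1 sE; pose o i (i3 : i < 3) := Ordinal i3.
rewrite (@odd_perm_ord3 s (o 0 isT) (o 1 isT) (o 2 isT)) // /parity3 !sE.
by rewrite -!rows3_sigma.
Qed.

Lemma no_factorization3 : False.
Proof.
have /card_gt0P[t0 _] := T_gt0.
have c k t : cnt k t = cnt k t0 by apply: (vcount_const sphi phi_irr hP).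
have lt3 k : cnt k t0 < 3 by apply: (vcount_lt phi_irr hP).
have law t : parity_law3 (rows3 t).
  apply: parity_law3P (rows3_admissible t).
  by do 3 (apply/andP; split; first exact: row3_perm).
have law_count t k : k < 4 -> count3 (rows3 t) k = cnt (inord k) t0.
  by move=> k4; rewrite -(c _ t) -rows3_count inordK.
have parP k : cnt k t0 <= 1 ->
    (\big[addb/false]_t parity3 (rows3 t) k) (+) odd_perm shift_perm
    = (cnt k t0 != 1).
  move=> ck; have [s sE] := sigma_perm ck; rewrite -(colour_parity ck sE).
  congr (_ (+) _); apply: eq_bigr => t _; rewrite (odd_sigma (k := k) (t := t)) ?c //.
have cnt_sum := sum_vcount h t0; rewrite !big_ord_recl big_ord0 in cnt_sum.
(* Counts [1, 1, 1, 0]: in the sum of [colour_parity] over four colours the shift cancels, the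
   layers contribute [true] an even number of times, and exactly one right-hand side is [true]. *)
have [/forallP small|] := boolP [forall k, cnt k t0 <= 1].
  have one t : \big[addb/false]_(k < 4) parity3 (rows3 t) k = true.
    have all_small : all (fun k => count3 (rows3 t) k <= 1) (iota 0 4).
      by apply/allP => k; rewrite mem_iota => k4; rewrite law_count.
    have /andP[/implyP/(_ all_small) + _] := law t.
    by rewrite !big_ord_recl big_ord0 addbF !addbA.
  have : \big[addb/false]_t \big[addb/false]_(k < 4) parity3 (rows3 t) k = false.
    rewrite (eq_bigr (fun=> true)) => [|t _]; last exact: one.
    transitivity (odd #|T|); last exact/negbTE.
    by rewrite big_const; elim: #|T| => [|i /= ->].
  rewrite exchange_big !big_ord_recl big_ord0 /=.
  have := parP _ (small ord0); have := parP _ (small (lift ord0 ord0)).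
  have := parP _ (small (lift ord0 (lift ord0 ord0))).
  have := parP _ (small (lift ord0 (lift ord0 (lift ord0 ord0)))).
  have := small ord0; have := small (lift ord0 ord0).
  have := small (lift ord0 (lift ord0 ord0)).
  have := small (lift ord0 (lift ord0 (lift ord0 ord0))).
  move: cnt_sum; do 4 (case: (cnt _ t0) => [|[|?]] //); move=> //= _ _ _ _ _;
    by do 4 (case: (\big[_/_]_t _)); case: (odd_perm _).
rewrite negb_forall => /existsP[a]; rewrite -ltnNge => a2.
have [b /eqP b1] : exists b, cnt b t0 == 1.
  apply/existsP; apply: contraT; rewrite negb_exists => /forallP n1.
  have := n1 ord0; have := n1 (lift ord0 ord0).
  have := n1 (lift ord0 (lift ord0 ord0)).
  have := n1 (lift ord0 (lift ord0 (lift ord0 ord0))).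
  have := lt3 ord0; have := lt3 (lift ord0 ord0).
  have := lt3 (lift ord0 (lift ord0 ord0)).
  have := lt3 (lift ord0 (lift ord0 (lift ord0 ord0))).
  by move: cnt_sum; do 4 (case: (cnt _ t0) => [|[|[|?]]] //).
have [l /eqP l0] : exists l, cnt l t0 == 0.
  apply/existsP; apply: contraT; rewrite negb_exists => /forallP n0.
  have := n0 ord0; have := n0 (lift ord0 ord0).
  have := n0 (lift ord0 (lift ord0 ord0)).
  have := n0 (lift ord0 (lift ord0 (lift ord0 ord0))).
  by move: cnt_sum; do 4 (case: (cnt _ t0) => [|?] //); rewrite /= ?addSn ?addnS.
(* Counts [2, 1, 0, 0]: [b] and [l] have equal parity in every layer, but [colour_parity] gives them
   opposite totals. *)
have par_eq t : parity3 (rows3 t) b = parity3 (rows3 t) l.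
  have /andP[_ /implyP/(_ _)] := law t.
  have -> : has (fun k => count3 (rows3 t) k == 2) (iota 0 4).
    apply/hasP; exists (val a); first by rewrite mem_iota; apply: ltn_ord.
    by rewrite rows3_count c; have := lt3 a; lia.
  move=> /(_ isT) /allP/(_ (val b)); rewrite mem_iota => /(_ (ltn_ord b)).
  move/allP/(_ (val l)); rewrite mem_iota => /(_ (ltn_ord l)).
  by rewrite !rows3_count !c b1 l0 /= => /eqP.
have := parP b; have := parP l; rewrite b1 l0 => /(_ isT) + /(_ isT).
by rewrite (eq_bigr _ (fun t _ => par_eq t)) => ->.
Qed.
End NoFactorization3.

(** * Assembly by the size of the layers *)

Theorem wreath_dicycle_decomposable (T : finType) (G : rel T) (m : nat) :
  4 <= m -> irreflexive G -> ~~ odd #|T| -> hamiltonian_decomposable G ->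
  hamiltonian_decomposable (wreath G (@dicycle m)).
Proof.
move=> m4 irrG T_even; case: m m4 => [|[|[|[|[|[|[|h]]]]]]] // _.
- by apply: kit_wreath_decomposable layer_kit4 _ _; rewrite ?card_ord.
- by apply: kit_wreath_decomposable layer_kit5 _ _; rewrite ?card_ord.
- by apply: kit_wreath_decomposable layer_kit6 _ _; rewrite ?card_ord.
- have [kit] := layer_kit_large h.
  by apply: kit_wreath_decomposable kit _ _; rewrite ?card_option ?card_ord.
Qed.

Theorem theorem1p6 (T : finType) (G : rel T) (n m : nat)
  (G_strict : irreflexive G)
  (G_order : #|T| = n)
  (n_even : ~~ odd n)
  (G_dec : hamiltonian_decomposable G)
  (m_ge2 : 2 <= m) :
  [/\ (* S1 *)
      (~~ odd m -> 4 <= m -> 4 <= n ->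
         hamiltonian_decomposable (wreath G (@dicycle m))),
      (* S2 *)
      (m = 4 -> n = 2 ->
         hamiltonian_decomposable (wreath G (@dicycle m))),
      (* S3 *)
      (odd m -> 5 <= m ->
         hamiltonian_decomposable (wreath G (@dicycle m)))
    & digraph_iso G (@dicycle n) -> (m = 2 \/ m = 3) ->
         ~ hamiltonian_decomposable (wreath G (@dicycle m))].
Proof.
have T_even : ~~ odd #|T| by rewrite G_order.
split=> [_ m4 _|-> _|_ m5|iso m23 dec].
- exact: wreath_dicycle_decomposable.
- exact: wreath_dicycle_decomposable.
- by apply: wreath_dicycle_decomposable => //; apply: ltnW.
- have [phi [sphi irr T1 [h hP]]] :=
    wreath_functional_factorization G_strict G_dec iso dec.
  case: m23 => E; subst m.
    exact: (no_factorization2 sphi irr (ltnW T1) hP).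
  exact: (no_factorization3 sphi irr hP (ltnW T1) T_even).
Qed.
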